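(* Let $r>0$ and let $p^B_r$ denote the density (with respect to Lebesgue measure on $\mathbb{R}$) of the area $B_T=\int_0^T W^r_t\,dt$ of reset Brownian motion with reset rate $r$. Then $B_T$ satisfies the central limit theorem: with $\sigma^2=2/r^2$, i.e. $\sigma=\sqrt2/r$, $$\lim_{T\to\infty}\sigma\sqrt{T}\;p^B_r\big(\sigma\sqrt{T}\,b\big)=\frac{1}{\sqrt{2\pi}}\,e^{-b^2/2},\qquad b\in\mathbb{R}.$$
   Context: Reset Brownian motion (rBM): given a Poisson process on $[0,\infty)$ of intensity $r>0$, the process $(W^r_t)_{t\ge 0}$ starts at $0$, evolves as a standard Brownian motion on $\mathbb{R}$, and at each Poisson point is placed back at $0$, from where it continues as a fresh standard Brownian motion started at $0$; the successive Brownian pieces are independent of each other and of the Poisson process. The density $p^B_r$ depends on $T$, which is suppressed from the notation. *)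

(* Defs.v *)
From HB Require Import structures.
From mathcomp Require Export all_boot all_order all_algebra.
From mathcomp Require Export finmap.
From mathcomp Require Export all_classical all_reals all_analysis.

Set Implicit Arguments.
Unset Strict Implicit.
Unset Printing Implicit Defensive.

Import Order.TTheory GRing.Theory Num.Theory.
Export numFieldNormedType.Exports.

Local Open Scope classical_set_scope.
Local Open Scope ring_scope.

Section independence.
Context d (Omega : measurableType d) (R : realType) (P : probability Omega R).

Definition mutually_independent (I : choiceType) (F : I -> set_system Omega) :=
  forall (J : {fset I}) (A : I -> set Omega),
    (forall i, i \in J -> F i (A i)) ->
    P (\bigcap_(i in [set` J]) A i) = (\prod_(i <- J) P (A i))%E.

Definition sigma_rv d' (T : measurableType d') (X : Omega -> T)
  : set_system Omega := preimage_set_system setT X measurable.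

Definition sigma_process d' (T : measurableType d') (X : R -> Omega -> T)
  : set_system Omega := <<s \bigcup_(t in `[0, +oo[) sigma_rv (X t) >>.

(* Independence of increments over finitely many times 0 <= u_0 <= ... <= u_n
   is the case of a sequence u that is constant from n on: the remaining
   increments vanish. *)
Definition independent_increments d' (T : measurableType d')
    (incr : R -> R -> Omega -> T) :=
  forall u : nat -> R, 0 <= u 0%N -> {homo u : m n / (m <= n)%N >-> m <= n} ->
    mutually_independent (fun i => sigma_rv (incr (u i) (u i.+1))).

(* Processes are indexed by R; only the times t >= 0 are constrained or used. *)
Definition is_brownian_motion (B : R -> {RV P >-> R}) :=
  [/\ forall w, B 0 w = 0,
      forall w, {within `[0, +oo[, continuous (fun t : R => B t w)},
      independent_increments (fun s t w => B t w - B s w) &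
      forall s t : R, 0 <= s -> s < t -> forall A, measurable A ->
        pushforward P (fun w => B t w - B s w) A
        = normal_prob 0 (Num.sqrt (t - s)) A].

(* The second argument of [poisson_prob] plays no role in its value. *)
Definition is_poisson_process (r : R) (N : R -> {RV P >-> nat}) :=
  [/\ forall w, N 0 w = 0%N,
      forall w (s t : R), 0 <= s -> s <= t -> (N s w <= N t w)%N,
      forall w (t : R), 0 <= t -> \forall s \near t^'+, N s w = N t w,
      independent_increments (fun s t w => N t w - N s w)%N &
      forall s t : R, 0 <= s -> s < t -> forall A, measurable A ->
        pushforward P (fun w => N t w - N s w)%N A
        = poisson_prob (r * (t - s)) 1 A].

End independence.

Section reset_brownian_motion.
Context d (Omega : measurableType d) (R : realType) (P : probability Omega R).
Implicit Types (N : R -> {RV P >-> nat}) (B : nat -> R -> {RV P >-> R}).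

(* [None] indexes the Poisson process, [Some n] the n-th Brownian piece. *)
Definition independent_pieces N B :=
  mutually_independent P (fun i : option nat =>
    if i is Some n then sigma_process (B n) else sigma_process N).

(* The last point of N in ]0, t], or 0 if there is none. *)
Definition last_reset N (t : R) (w : Omega) : R :=
  inf [set s | 0 <= s /\ N s w = N t w].

Definition reset_brownian N B (t : R) (w : Omega) : R :=
  B (N t w) (t - last_reset N t w) w.

Definition reset_area N B (T : R) (w : Omega) : R :=
  (\int[lebesgue_measure]_(t in `[0%R, T]) reset_brownian N B t w)%R.

Definition has_density (X : Omega -> R) (f : R -> R) :=
  [/\ measurable_fun setT X, measurable_fun setT f, forall x, 0 <= f x &
      forall A, measurable A ->
        P (X @^-1` A) = (\int[lebesgue_measure]_(x in A) (f x)%:E)%E].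

(* A density is only determined almost everywhere; pointwise statements refer
   to its continuous version, which is unique. *)
Definition has_continuous_density (X : Omega -> R) (f : R -> R) :=
  has_density X f /\ continuous f.

End reset_brownian_motion.

(* Main.v *)
(** Given the Poisson process, B_T is a centred Gaussian with variance
    V_T = int_0^T (t - last reset before t)^2 dt.  Hence p_T(x) = E[phi_{V_T}(x)],
    where phi_v is the density of N(0, v).  This mixture is Lipschitz in x because
    E[1/V_T] is finite: by Cauchy-Schwarz V_T >= T^3 / (4 K^2), where K is the
    number of Brownian pieces.  The age process satisfies a Poisson equation, so
    V_T - (2/r^2) T is a martingale plus a boundary term bounded in L^2, and its
    second moment is O(T).  Since u |-> u exp(-(b u)^2 / 2) is 1-Lipschitz, the scaled density
    differs from the Gaussian one by at most a multiple of
    E|sigma sqrt(T / V_T) - 1| = O(T^(-1/2)).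

    Both the conditional law and the moments are obtained on the grid of mesh
    T/(n+1), where conditioning on the Poisson process is a countable partition
    and its increments reduce to Bernoulli trials; then n tends to infinity. *)
Require Import Defs.
From HB Require Import structures.
From mathcomp Require Import measurable_realfun zify ring lra.

Set Implicit Arguments.
Unset Strict Implicit.
Unset Printing Implicit Defensive.

Import Order.TTheory GRing.Theory Num.Theory.

Local Open Scope classical_set_scope.
Local Open Scope ring_scope.

(** * Gaussian laws *)

(** The constant [2 / r ^ 2] is the second moment of the equilibrium age, an exponential variable of
    rate [r]. Convergence of densities asks for more than convergence of laws: the Gaussian kernel
    has height of order V_T^(-1/2), and V_T is small on paths with many resets, so concentration of
    V_T / T does not by itself rule out a contribution from them. The inverse moment is therefore
    needed with its size O(1/T), and not only its finiteness; it is paired with the O(T) second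
    moment of the deviation. The passage from the grid to continuous time is shaped by what survives
    a pointwise limit. Expectations of bounded continuous functions converge, and these identify the
    law; for unbounded quantities only upper bounds persist, by Fatou. Both moments are therefore
    upper bounds uniform in the mesh, and no expectation of V_T is computed in continuous time. The
    grid area is built from ages counted on the grid, not from exact reset times, so that given the
    finitely many grid values of the Poisson process it is exactly Gaussian with an explicit
    variance. *)

Section gauss.
Context {R : realType}.
Implicit Types (m s a b c : R).

(** Half-open intervals are stable under intersection and generate the Borel sets; finite mass lets
    the measure of each be written as a difference of two rays. *)
Lemma measure_eq_rays (m1 m2 : {measure set (measurableTypeR R) -> \bar R}) :
  (m1 setT < +oo)%E -> (m2 setT < +oo)%E ->
  (forall x, m1 `]-oo, x]%classic = m2 `]-oo, x]%classic) ->
  forall A, measurable A -> m1 A = m2 A.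
Proof.
move=> m1y m2y m12 A mA.
have fin (mu : {measure set (measurableTypeR R) -> \bar R}) B : measurable B ->
    (mu setT < +oo)%E -> (mu B < +oo)%E.
  by move=> mB; apply: le_lt_trans; apply: le_measure; rewrite ?inE.
apply: (@measure_unique _ R (measurableTypeR R) (@ocitv R) (fun n : nat => `](- n%:R), n%:R]%classic)) => //.
- exact: ocitvI.
- by move=> n; exact: is_ocitv.
- rewrite -subTset => x _; exists (Num.trunc `|x|).+1 => //=.
  rewrite in_itv/=.
  have := truncnS_gt `|x|; rewrite ltr_norml => /andP[-> /ltW ->] //.
- move=> _ [[x y] _ <-]/=.
  have [xy|yx] := leP x y; last first.
    by rewrite set_itv_ge ?measure0// bnd_simp -leNgt ltW.
  have -> : `]x, y]%classic = `]-oo, y] `\` `]-oo, x].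
    apply/seteqP; split=> z /=; rewrite !in_itv/=.
      by move=> /andP[xz ->]; split=> //; apply/negP; rewrite -ltNge.
    by move=> [-> /negP]; rewrite -ltNge => ->.
  have sub : `]-oo, y] `&` `]-oo, x] = `]-oo, x]%classic.
    by rewrite setIidr//; apply: subset_itvl; rewrite bnd_simp.
  rewrite !measureD ?sub//=; [|exact: fin..].
  by rewrite !m12.
- by move=> k; exact: fin.
Qed.

Lemma normal_prob_itvoc m s a b : 0 < s -> a <= b ->
  normal_prob m s `]a, b] = normal_prob 0 1 `]((a - m) / s), ((b - m) / s)].
Proof.
move=> s0 ab; rewrite /normal_prob.
have mpdf (m1 s1 : R) (D : set R) : measurable_fun D (EFin \o normal_pdf m1 s1).
  apply/measurable_EFinP; apply: measurable_funTS.
  exact: measurable_normal_pdf.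
rewrite integral_itv_obnd_cbnd; last exact: mpdf.
rewrite [RHS]integral_itv_obnd_cbnd; last exact: mpdf.
pose F (x : R) : R := (x - m) / s.
have dF x : is_derive (x : R) 1 F s^-1.
  rewrite /F; apply: is_derive_eq.
  by rewrite scaler0 add0r subr0 /GRing.scale/= mulr1.
have F'E : F^`()%classic = cst s^-1.
  by apply/funext => x; rewrite derive1E derive_val.
rewrite (@integration_by_substitution_increasing _ F (normal_pdf 0 1))//.
- apply: eq_integral => x _; congr EFin.
  rewrite F'E; change (normal_pdf m s x = normal_pdf 0 1 (F x) * s^-1).
  rewrite !normal_pdfE ?gt_eqF// /normal_peak /normal_fun /F [RHS]mulrAC.
  congr (_ * expR _).
    rewrite -(mulrnAr _ pi) -(mulrnAr _ pi) sqrtrM ?sqr_ge0// sqrtr_sqr gtr0_norm// invfM.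
    by rewrite expr1n mul1r mulrC.
  by field; rewrite gt_eqF.
- by move=> x y _ _ xy; rewrite /F ltr_pM2r ?invr_gt0// ltrD2r.
- by rewrite F'E => x _; exact: cvg_cst.
- by rewrite F'E; exact: is_cvg_cst.
- by rewrite F'E; exact: is_cvg_cst.
- have cF : continuous F.
    by move=> x; apply: differentiable_continuous; apply/derivable1_diffP.
  split.
  + by move=> x _; exact: ex_derive.
  + exact/cvg_at_right_filter/cF.
  + exact/cvg_at_left_filter/cF.
- apply: continuous_subspaceT; apply: continuous_normal_pdf.
  exact: oner_neq0.
Qed.

Definition affine (s m : R) (z : measurableTypeR R) : measurableTypeR R :=
  s * (z : R) + m.

Lemma measurable_affine (s m : R) : measurable_fun setT (affine s m).
Proof.
by apply: measurable_funD => //; apply: measurable_funM.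
Qed.

HB.instance Definition _ (s m : R) :=
  isMeasurableFun.Build _ _ _ _ (affine s m) (measurable_affine s m).

(** Standardisation is a change of variables on bounded intervals; continuity from below carries it
    to rays, and rays determine the law. *)
Lemma normal_probE m s A : 0 < s -> measurable A ->
  normal_prob m s A = normal_prob 0 1 (affine s m @^-1` A).
Proof.
move=> s0 mA.
suff : forall x, normal_prob m s `]-oo, x] =
    pushforward (normal_prob 0 1) (affine s m) `]-oo, x].
  move=> h.
  have N1 m' s' : normal_prob m' s' setT = 1%E.
    exact: (@probability_setT _ _ _ (normal_prob m' s')).
  apply: (@measure_eq_rays (normal_prob m s)
    (pushforward (normal_prob 0 1) (affine s m)) _ _ h) => //.
    by rewrite /= N1 ltry.
  by rewrite /= /pushforward preimage_setT N1 ltry.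
move=> x.
have cvgl (P : probability (measurableTypeR R) R) (u : nat -> R) (y : R) :
    {homo u : n k / (n <= k)%N >-> k <= n} -> (forall z, exists n, u n < z) ->
    P `]u n, y]%classic @[n --> \oo] --> P `]-oo, y]%classic.
  move=> hu uNy.
  have -> : `]-oo, y]%classic = \bigcup_n `]u n, y]%classic.
    apply/seteqP; split=> z /=.
      rewrite in_itv/= => zy; have [n unz] := uNy z; exists n => //=.
      by rewrite in_itv/= unz.
    by move=> [n _ /=]; rewrite !in_itv/= => /andP[].
  apply: nondecreasing_cvg_mu => //.
    exact: bigcup_measurable.
  move=> n k nk; apply/subsetPset => z /=; rewrite !in_itv/= => /andP[+ ->].
  by rewrite andbT; apply: le_lt_trans; exact: hu.
have exn (z : R) : exists n : nat, - n%:R < z.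
  exists (Num.trunc `|z|).+1; have := truncnS_gt `|z|.
  by rewrite ltr_norml => /andP[].
have h1 : normal_prob m s `](- n%:R), x]%classic @[n --> \oo] -->
    normal_prob m s `]-oo, x]%classic.
  by apply: cvgl => // n k nk; rewrite lerN2 ler_nat.
have := @cvgl (normal_prob 0 1) (fun n => (- n%:R - m) / s) ((x - m) / s).
move=> h2.
have {}h2 : normal_prob 0 1 `](- n%:R - m) / s, (x - m) / s]%classic @[n --> \oo] -->
   pushforward (normal_prob 0 1) (affine s m) `]-oo, x]%classic.
  rewrite /pushforward/=.
  have -> : affine s m @^-1` `]-oo, x] = `]-oo, (x - m) / s]%classic.
    apply/seteqP; split=> z /=; rewrite !in_itv/= ler_pdivlMr// mulrC lerBrDr//.
  apply: h2.
    move=> n k nk; rewrite ler_pM2r ?invr_gt0// lerD2r lerN2 ler_nat//.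
  move=> z; have [n hn] := exn (z * s + m); exists n.
  by rewrite ltr_pdivrMr// ltrBlDr.
have -> : normal_prob m s `]-oo, x]%classic = lim (normal_prob m s `](- n%:R), x]%classic @[n --> \oo]).
  by apply/esym/cvg_lim.
apply: cvg_lim => //.
apply: cvg_trans h2; apply: near_eq_cvg; near=> n.
rewrite (@normal_prob_itvoc m s (- n%:R) x)//.
near: n.
have [n hn] := exn x; exists n => // k /= nk; apply: ltW; apply: le_lt_trans hn.
by rewrite lerN2 ler_nat.
Unshelve. all: by end_near. Qed.

End gauss.

(** * Integration against a measure given by a density *)

Section density.
Context {R : realType} d (T : measurableType d).
Variables (mu nu : {measure set T -> \bar R}) (p : T -> R).
Hypotheses (p0 : forall x, 0 <= p x) (mp : measurable_fun setT p).
Hypothesis nuE : forall A, measurable A -> nu A = (\int[mu]_(x in A) (p x)%:E)%E.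
Import HBNNSimple.

Lemma integral_density_nnsfun (f : {nnsfun T >-> R}) :
  (\int[nu]_x (f x)%:E = \int[mu]_x ((f x)%:E * (p x)%:E))%E.
Proof.
under [LHS]eq_integral do rewrite fimfunE -fsumEFin//.
rewrite [LHS]ge0_integral_fsum//; last 2 first.
  - by move=> r; exact/measurable_EFinP/measurableT_comp.
  - by move=> n x _; rewrite EFinM nnfun_muleindic_ge0.
under [RHS]eq_integral.
  move=> x xD; rewrite fimfunE -fsumEFin// ge0_mule_fsuml; last first.
    by move=> r; rewrite EFinM nnfun_muleindic_ge0.
  over.
rewrite [RHS]ge0_integral_fsum//; last 2 first.
  - move=> r; rewrite -[X in measurable_fun _ X]/(EFin \o (fun x => r * \1_(f @^-1` [set r]) x * p x)).
    apply/measurable_EFinP; apply: measurable_funM => //.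
    exact: measurableT_comp.
  - move=> n x _; rewrite EFinM mule_ge0//; first by rewrite nnfun_muleindic_ge0.
    by rewrite lee_fin.
apply: eq_fsbigr => r _.
rewrite [LHS]integralZl_indic_nnsfun//= integral_indic// setIT nuE//.
have [r0|r0] := ltP r 0.
  rewrite preimage_nnfun0//.
  rewrite integral_set0 mule0 integral0_eq// => x _.
  by rewrite indicE in_set0 mulr0 mul0e.
rewrite -ge0_integralZl//.
- rewrite integral_mkcond/=; apply: eq_integral => x _.
  rewrite patchE indicE; case: ifP => _; first by rewrite mulr1.
  by rewrite mulr0 mul0e.
- exact/measurable_EFinP/measurable_funTS.
- by move=> x _; rewrite lee_fin.
Qed.

(** Simple functions first, then monotone convergence on both sides. With an indicator as density
    this also covers integrals over an event. *)
Lemma integral_density (f : T -> \bar R) :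
  measurable_fun setT f -> (forall x, 0 <= f x)%E ->
  (\int[nu]_x f x = \int[mu]_x (f x * (p x)%:E))%E.
Proof.
move=> mf f0.
pose f_ := nnsfun_approx measurableT mf.
transitivity (lim (\int[nu]_x (f_ n x)%:E @[n --> \oo])%E).
  rewrite -monotone_convergence//=.
  - apply: eq_integral => ? /[!inE] xD; apply/esym/cvg_lim => //=.
    exact: cvg_nnsfun_approx.
  - by move=> n; exact/measurable_EFinP/measurable_funTS.
  - by move=> n ? _; rewrite lee_fin.
  - by move=> ? _ ? ? mn; rewrite lee_fin; exact/lefP/nd_nnsfun_approx.
transitivity (lim (\int[mu]_x ((f_ n x)%:E * (p x)%:E) @[n --> \oo])%E); last first.
  rewrite -monotone_convergence//=.
  - apply: eq_integral => x /[!inE] xD; apply/cvg_lim => //.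
    apply: cvgeZr => //.
    exact: cvg_nnsfun_approx.
  - move=> n; rewrite -[X in measurable_fun _ X]/(EFin \o (fun x => f_ n x * p x)).
    exact/measurable_EFinP/measurable_funM.
  - by move=> n ? _; rewrite mule_ge0 ?lee_fin.
  - move=> x _ m n mn; rewrite lee_wpmul2r ?lee_fin//; exact/lefP/nd_nnsfun_approx.
by apply: congr_lim; apply/funext => n /=; exact: integral_density_nnsfun.
Qed.

End density.

(** * Sums of independent Gaussian variables *)

Section gauss_conv.
Context {R : realType}.
Implicit Types (a b c x y : R).

(* Completing the square: the second factor on the right integrates to 1. *)
Lemma normal_pdf_mul a b x y : 0 < b ->
  normal_pdf 0 1 x * normal_pdf (a * x) b y =
  normal_pdf 0 (Num.sqrt (a ^+ 2 + b ^+ 2)) y *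
  normal_pdf (a * y / (a ^+ 2 + b ^+ 2)) (b / Num.sqrt (a ^+ 2 + b ^+ 2)) x.
Proof.
move=> b0; set c := Num.sqrt _.
have ab0 : 0 < a ^+ 2 + b ^+ 2 by rewrite ltr_wpDl ?sqr_ge0 ?exprn_gt0.
have c0 : 0 < c by rewrite sqrtr_gt0.
have c2 : a ^+ 2 + b ^+ 2 = c ^+ 2 by rewrite sqr_sqrtr// ltW.
rewrite !normal_pdfE ?gt_eqF ?divr_gt0// /normal_peak /normal_fun.
rewrite [LHS]mulrACA [RHS]mulrACA -!expRD -!invfM -!sqrtrM; first last.
- by rewrite mulrn_wge0// mulr_ge0 ?pi_ge0 ?sqr_ge0.
- by rewrite mulrn_wge0// mulr_ge0 ?pi_ge0 ?sqr_ge0.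
rewrite c2; congr ((Num.sqrt _)^-1 * expR _).
  by field; rewrite gt_eqF.
have b2 : b ^+ 2 = c ^+ 2 - a ^+ 2 by rewrite -c2 addrAC subrr add0r.
have cb : c ^+ 2 - a ^+ 2 != 0 by rewrite -b2 gt_eqF// exprn_gt0.
rewrite exprMn exprVn b2.
by field; rewrite cb gt_eqF.
Qed.

End gauss_conv.

Section gauss_law.
Context {R : realType}.
Implicit Types (a b c v w x y : R).
Local Notation mR := (measurableTypeR R).
Local Notation std := (@normal_prob R 0 1).
Local Notation mu := (@lebesgue_measure R).

Definition uncurry_affine a b (z : mR * mR) : mR := affine b (a * z.1) z.2.

Lemma measurable_uncurry_affine a b : measurable_fun setT (uncurry_affine a b).
Proof. by apply: measurable_funD; apply: measurable_funM. Qed.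

Lemma xsection_preimage_affine a b x (A : set mR) :
  xsection (uncurry_affine a b @^-1` A) x = affine b (a * x) @^-1` A.
Proof. by apply/seteqP; split=> y; rewrite /xsection/= inE. Qed.

(** The left side is the law of [a X + b Y] for independent standard [X] and [Y]. Tonelli moves the
    integral over the value [y] of the sum outside; after completing the square the integral over
    [x] is the total mass of a Gaussian density. *)
Lemma std_conv_pos a b A : 0 < b -> measurable A ->
  (\int[std]_x std (affine b (a * x) @^-1` A) =
   normal_prob 0 (Num.sqrt (a ^+ 2 + b ^+ 2)) A)%E.
Proof.
move=> b0 mA.
pose c := Num.sqrt (a ^+ 2 + b ^+ 2).
have ab0 : 0 < a ^+ 2 + b ^+ 2 by rewrite ltr_wpDl ?sqr_ge0 ?exprn_gt0.
have c0 : 0 < c by rewrite sqrtr_gt0.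
pose K (z : mR * mR) : \bar R :=
  (\1_A z.2 * (normal_pdf 0 1 z.1 * normal_pdf (a * z.1) b z.2))%:E.
have mpdf m s : measurable_fun setT (fun z : mR * mR => normal_pdf (m * z.1) s z.2).
  rewrite /normal_pdf; case: (eqVneq s 0) => _.
    by apply: measurableT_comp => //; exact: measurable_indic.
  apply: measurable_funM => //.
  rewrite /normal_fun.
  apply: measurableT_comp => //; apply: measurable_funM => //.
  apply: measurableT_comp => //; apply: measurable_funX.
  by apply: measurable_funB => //; apply: measurable_funM.
have mK : measurable_fun setT K.
  apply/measurable_EFinP; apply: measurable_funM.
    by apply: measurableT_comp => //; exact: measurable_indic.
  apply: measurable_funM => //.
  by apply: measurableT_comp measurable_fst => //; exact: measurable_normal_pdf.
have K0 z : (0 <= K z)%E by rewrite lee_fin !mulr_ge0 ?normal_pdf_ge0.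
have H x : std (affine b (a * x) @^-1` A) = (\int[mu]_(y in A) (normal_pdf (a * x) b y)%:E)%E.
  by rewrite -normal_probE.
rewrite (@integral_density _ _ _ mu std (normal_pdf 0 1))//; first last.
- apply: (eq_measurable_fun (std \o xsection (uncurry_affine a b @^-1` A))).
    by move=> x _; rewrite /= xsection_preimage_affine.
  apply: measurable_fun_xsection.
  by rewrite -[X in measurable X]setTI; exact: measurable_uncurry_affine.
- exact: measurable_normal_pdf.
- by move=> x; exact: normal_pdf_ge0.
transitivity (\int[mu]_x \int[mu]_y K (x, y))%E.
  apply: eq_integral => x _; rewrite H muleC -ge0_integralZl//; first last.
  - by rewrite lee_fin normal_pdf_ge0.
  - by move=> y _; rewrite lee_fin normal_pdf_ge0.
  - apply/measurable_EFinP/measurable_funTS; exact: measurable_normal_pdf.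
  rewrite integral_mkcond; apply: eq_integral => y _.
  rewrite patchE /K/= indicE; case: ifP => _; first by rewrite mul1r.
  by rewrite mul0r.
rewrite fubini_tonelli//.
rewrite /normal_prob [RHS]integral_mkcond; apply: eq_integral => y _.
rewrite /K/= patchE indicE; case: ifP => _; last first.
  by apply: integral0_eq => x _; rewrite mul0r.
under eq_integral do rewrite mul1r normal_pdf_mul// EFinM.
rewrite ge0_integralZl//; first last.
- by rewrite lee_fin normal_pdf_ge0.
- by move=> x _; rewrite lee_fin normal_pdf_ge0.
- by apply/measurable_EFinP; exact: measurable_normal_pdf.
by rewrite integral_normal_pdf mule1.
Qed.

Lemma std_conv a b A : 0 <= a -> 0 <= b -> measurable A ->
  (\int[std]_x std (affine b (a * x) @^-1` A) =
   std (affine (Num.sqrt (a ^+ 2 + b ^+ 2)) 0 @^-1` A))%E.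
Proof.
move=> a0; rewrite le_eqVlt => /predU1P[<-|b0] mA; last first.
  rewrite std_conv_pos// normal_probE// sqrtr_gt0.
  by rewrite ltr_wpDl ?sqr_ge0 ?exprn_gt0.
rewrite expr0n addr0 sqrtr_sqr ger0_norm//.
have mB : measurable (affine a 0 @^-1` A).
  by rewrite -[X in measurable X]setTI; exact: measurable_affine.
rewrite -[in RHS](setIT (affine a 0 @^-1` A)) -integral_indic//; apply: eq_integral => x _.
rewrite indicE; case: (boolP (x \in _)); rewrite ?inE ?notin_setE /affine/= addr0 => axA.
  transitivity (std setT); last exact: (@probability_setT _ _ _ std).
  by congr (std _); apply/seteqP; split=> z //=; rewrite mul0r add0r.
transitivity (std set0); last by rewrite measure0.
by congr (std _); apply/seteqP; split=> z //=; rewrite mul0r add0r.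
Qed.

(** An image of the standard law, so that variance 0 gives the point mass at 0, the law of an empty
    sum. In this form the variance can also be moved into the integrand, which makes means
    continuous in [v]. *)
Definition gauss_law v : probability mR R :=
  distribution std (affine (Num.sqrt v) 0).

#[local] Arguments gauss_law : simpl never.

Lemma gauss_lawE v A : 0 < v -> measurable A ->
  gauss_law v A = normal_prob 0 (Num.sqrt v) A.
Proof. by move=> v0 mA; rewrite normal_probE// sqrtr_gt0. Qed.

(** Conditioning on [E] in product form: no division appears in the statement. When [P E] is
    positive, the joint law on [E] rescaled by its inverse agrees with a product measure on
    rectangles, hence everywhere, and the convolution formula applies. *)
Lemma gauss_law_sum d (Omega : measurableType d) (P : probability Omega R)
    (E : set Omega) (X Y : Omega -> R) v w c :
  measurable E -> measurable_fun setT X -> measurable_fun setT Y ->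
  0 <= v -> 0 <= w -> 0 <= c ->
  (forall A B, measurable A -> measurable B ->
    P (E `&` X @^-1` A `&` Y @^-1` B) = P E * (gauss_law v A * gauss_law w B))%E ->
  forall A, measurable A ->
    (P (E `&` (fun o => c * X o + Y o)%R @^-1` A) =
     P E * gauss_law (c ^+ 2 * v + w)%R A)%E.
Proof.
move=> mE mX mY v0 w0 c0 XY A mA.
pose XY1 (o : Omega) : mR * mR := (X o, Y o).
have mXY : measurable_fun setT XY1 by exact: measurable_fun_pair.
pose f : {mfun Omega >-> (mR * mR)%type} := mfun_Sub (mem_set mXY).
pose nu := pushforward (mrestr P mE) f.
have PEfin : (0 <= fine (P E))%R by rewrite fine_ge0.
have PE : P E = (fine (P E))%:E by rewrite fineK// fin_num_measure.
have mcXY : measurable (E `&` (fun o => c * X o + Y o) @^-1` A).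
  apply: measurableI => //; rewrite -[X in measurable X]setTI.
  by apply: measurable_funD => //; exact: measurable_funM.
have [PE0|PE0] := eqVneq (P E) 0%E.
  rewrite PE0 mul0e; apply/eqP; rewrite -measure_le0 -PE0.
  by apply: le_measure; rewrite ?inE.
have pV : (0 <= (fine (P E))^-1)%R by rewrite invr_ge0.
pose p := NngNum pV.
have PEV : (P E * p%:num%:E = 1)%E.
  rewrite PE -EFinM divff// -eqe -PE; exact: PE0.
have h := @product_measure_unique _ _ mR mR R (gauss_law v) (gauss_law w)
  (mscale p nu).
have {}h Z : measurable Z -> (nu Z = P E * (gauss_law v \x gauss_law w) Z)%E.
  move=> mZ; rewrite h//; first by rewrite /mscale/= muleA PEV mul1e.
  move=> B C mB mC.
  transitivity ((p%:num)%:E * P (f @^-1` (B `*` C) `&` E))%E; first by [].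
  rewrite setIC (_ : _ `&` _ = E `&` X @^-1` B `&` Y @^-1` C); last first.
    by apply/seteqP; split=> o /=; rewrite /XY1/=; [move=> [? []]|move=> [[]]].
  by rewrite XY// muleA (muleC _ (P E)) PEV mul1e.
have -> : E `&` (fun o => c * X o + Y o) @^-1` A =
    f @^-1` (uncurry_affine c 1 @^-1` A) `&` E.
  rewrite setIC; congr (_ `&` _); apply/seteqP; split=> o /=;
  by rewrite /uncurry_affine /affine/= mul1r addrC.
have mZ (a b : R) : measurable (uncurry_affine a b @^-1` A).
  by rewrite -[X in measurable X]setTI; exact: measurable_uncurry_affine.
rewrite -[LHS]/(nu _) h//; congr (_ * _)%E.
rewrite /product_measure1/= ge0_integral_pushforward//; first last.
- exact: (measurable_fun_xsection (gauss_law w) (mZ c 1)).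
transitivity (\int[std]_x std (affine (Num.sqrt w) (c * Num.sqrt v * x) @^-1` A))%E.
  apply: eq_integral => x _ /=; rewrite xsection_preimage_affine.
  rewrite /distribution /pushforward; congr (std _).
  congr (_ @^-1` A); apply/funext => y.
  by rewrite /= /uncurry_affine /affine; ring.
rewrite std_conv// ?mulr_ge0 ?sqrtr_ge0//.
by rewrite exprMn !sqr_sqrtr.
Qed.

End gauss_law.
Arguments gauss_law {R} v : simpl never.

Section gauss_bigsum.
Context {R : realType} d (Omega : measurableType d) (P : probability Omega R).
Local Open Scope ereal_scope.

Lemma gauss_law0 (A : set R) : gauss_law (0 : R) A = (\1_A (0 : R) : R)%:E.
Proof.
rewrite /gauss_law /distribution /pushforward/= sqrtr0 indicE.
have [A0|A0] := boolP (_ \in A).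
  rewrite (_ : _ @^-1` _ = setT); last first.
    by rewrite -subTset => z _; move: A0; rewrite inE /affine/= mul0r addr0.
  exact: (@probability_setT _ _ _ (@normal_prob R 0 1)).
rewrite (_ : _ @^-1` _ = set0) ?measure0//.
rewrite -subset0 => z; rewrite /affine/= mul0r addr0.
by move: A0; rewrite notin_setE.
Qed.

Lemma bigsetI_measurable (I : eqType) (s : seq I) (F : I -> set Omega) :
  (forall i, measurable (F i)) -> measurable (\big[setI/setT]_(i <- s) F i).
Proof. by move=> mF; elim/big_ind : _ => //; exact: measurableI. Qed.

(** The induction quantifies over [E]: the constraint on the first variable is absorbed into the
    event, so the tail sum is obtained jointly with that variable. *)
Lemma gauss_law_bigsum (I : eqType) (s : seq I) (E : set Omega)
    (X : I -> Omega -> R) (v c : I -> R) :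
  uniq s -> measurable E -> (forall i, measurable_fun setT (X i)) ->
  (forall i, (0 <= v i)%R) -> (forall i, (0 <= c i)%R) ->
  (forall A : I -> set R, (forall i, measurable (A i)) ->
    P (E `&` \big[setI/setT]_(i <- s) (X i @^-1` A i)) =
    P E * \prod_(i <- s) gauss_law (v i) (A i)) ->
  forall A, measurable A ->
    P (E `&` (fun o => \sum_(i <- s) c i * X i o)%R @^-1` A) =
    P E * gauss_law (\sum_(i <- s) c i ^+ 2 * v i)%R A.
Proof.
move=> us mE mX v0 c0; elim: s us E mE => [_ E mE _ A mA|i s IH /= /andP[iNs us] E mE XA].
  rewrite big_nil gauss_law0 indicE.
  have [A0|A0] := boolP (_ \in A).
    rewrite mule1 (_ : _ @^-1` _ = setT) ?setIT//.
    by rewrite -subTset => z _; move: A0; rewrite inE /= big_nil.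
  rewrite mule0 (_ : _ @^-1` _ = set0) ?setI0 ?measure0//.
  by rewrite -subset0 => z /=; rewrite big_nil; move: A0; rewrite notin_setE.
have mXB j B : measurable B -> measurable (X j @^-1` B).
  by move=> mB; rewrite -[X in measurable X]setTI; exact: mX.
have XA2 B (A : I -> set R) : measurable B -> (forall j, measurable (A j)) ->
    P (E `&` X i @^-1` B `&` \big[setI/setT]_(j <- s) (X j @^-1` A j)) =
    P E * gauss_law (v i) B * \prod_(j <- s) gauss_law (v j) (A j).
  move=> mB mA.
  have := XA (fun j => if j == i then B else A j).
  rewrite !big_cons eqxx setIA muleA.
  have neq j : j \in s -> (j == i) = false.
    by move=> js; apply/negbTE; apply: contraNneq iNs => <-.
  rewrite (eq_big_seq (fun j => X j @^-1` A j)); last by move=> j /neq ->.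
  rewrite (eq_big_seq (fun j => gauss_law (v j) (A j))); last by move=> j /neq ->.
  by apply=> j; case: ifP.
have PEX B : measurable B -> P (E `&` X i @^-1` B) = P E * gauss_law (v i) B.
  move=> mB; have := XA2 B (fun=> setT) mB (fun=> measurableT).
  rewrite (eq_bigr (fun=> setT)); last by move=> j _; rewrite preimage_setT.
  rewrite big1_eq setIT => ->.
  rewrite big1 ?mule1// => j _; exact: probability_setT.
move=> A mA; rewrite big_cons.
under [X in X @^-1` _]eq_fun do rewrite big_cons.
apply: (@gauss_law_sum _ _ _ _ _ (X i)
  (fun o => \sum_(j <- s) c j * X j o)%R) => //.
- by apply: measurable_sum => j; exact: measurable_funM.
- by apply: sumr_ge0 => j _; rewrite mulr_ge0 ?sqr_ge0.
move=> B C mB mC; rewrite IH//; last 2 first.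
- by apply: measurableI => //; exact: mXB.
- by move=> A' mA'; rewrite XA2// PEX.
by rewrite PEX// muleA.
Qed.

Lemma mutually_independent_seq (I : choiceType) (F : I -> set_system Omega)
    (s : seq I) (A : I -> set Omega) :
  mutually_independent P F -> uniq s -> (forall i, i \in s -> F i (A i)) ->
  P (\big[setI/setT]_(i <- s) A i) = \prod_(i <- s) P (A i).
Proof.
move=> indep us FA.
have sE : perm_eq [fset i in s]%fset s.
  by apply: uniq_perm => // i; rewrite inE.
have := indep [fset i in s]%fset A.
rewrite bigcap_fset !(perm_big _ sE)/=; apply => i.
by rewrite inE => /FA.
Qed.

End gauss_bigsum.

(** * Ages on a grid *)

Section age.
Variable m : nat -> nat.
Implicit Types (i j k n : nat).
Local Open Scope nat_scope.

Definition occ n k := \sum_(j < n) (m j == k).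

(* [occ n (m j)] counted up to [j]: for monotone [m], the number of grid steps
   since [m] last changed. *)
Definition age j := occ j (m j).

Lemma occS n k : occ n.+1 k = occ n k + (m n == k).
Proof. by rewrite /occ big_ord_recr. Qed.

Lemma occ_le n k : occ n k <= n.
Proof.
by elim: n => [|n IH]; rewrite ?/occ ?big_ord0// -/(occ _ _) occS -addn1 leq_add// leq_b1.
Qed.

(** Successive visits to a level have ages 0, 1, 2, ..., since the age counts the earlier visits. *)
Lemma sum_age_occ (F : nat -> nat) n k :
  \sum_(j < n | m j == k) F (age j) = \sum_(a < occ n k) F a.
Proof.
elim: n => [|n IH]; first by rewrite big_ord0 /occ !big_ord0.
rewrite big_mkcond big_ord_recr/= -big_mkcond IH occS /age.
by case: eqP => [->|_]; rewrite ?addn0// addn1 big_ord_recr.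
Qed.

(** The coefficient, up to the mesh, of the [i]-th increment of the [k]-th Brownian piece in the
    Riemann sum: that increment enters every value of the piece taken at an age above [i]. *)
Definition weight n k i := \sum_(j < n) (m j == k) * (i < age j).

Lemma sum_ltn_ord l i : \sum_(a < l) (i < a) = l - i.+1.
Proof.
elim: l => [|l IH]; first by rewrite big_ord0.
rewrite big_ord_recr/= IH.
by case: (ltnP i l) => il; lia.
Qed.

(** Truncated subtraction turns the terms with [i >= l] into [F 0 = 0]; the others list the
    right-hand sum backwards. *)
Lemma sum_sub_rev (F : nat -> nat) n l : F 0 = 0 -> l <= n ->
  \sum_(i < n) F (l - i.+1) = \sum_(a < l) F a.
Proof.
move=> F0; elim: n l => [|n IH] [|l] // ln; rewrite ?big_ord0//.
  by rewrite big1.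
rewrite big_ord_recl subSS subn0 big_ord_recr/= -IH// addnC; congr (_ + _).
Qed.

(* Both sides list 0, 1, ..., l - 1 for each level of multiplicity l, in opposite
   orders; this is the equality of the conditional variance and the Riemann sum
   of the squared age. *)
Lemma sum_weight_sq K n : (forall j, j < n -> m j < K) ->
  \sum_(k < K) \sum_(i < n) weight n k i ^ 2 = \sum_(j < n) age j ^ 2.
Proof.
move=> mK.
have wE k i : weight n k i = occ n k - i.+1.
  rewrite -sum_ltn_ord -(sum_age_occ (fun a => i < a)) /weight.
  rewrite [RHS]big_mkcond/=; apply: eq_bigr => j _.
  by case: eqP => _; rewrite ?mul1n ?mul0n.
transitivity (\sum_(k < K) \sum_(j < n | m j == k) age j ^ 2).
  apply: eq_bigr => k _; rewrite (sum_age_occ (fun a => a ^ 2)).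
  rewrite -(@sum_sub_rev (fun a => a ^ 2) n)// ?occ_le//.
  by apply: eq_bigr => i _; rewrite wE.
under eq_bigr do rewrite big_mkcond/=.
rewrite exchange_big/=; apply: eq_bigr => j _.
rewrite -big_mkcond/= (bigD1 (Ordinal (mK j (ltn_ord j))))//= big1 ?addn0//.
by move=> k /andP[/eqP mjk] /eqP; case; apply: val_inj.
Qed.

Lemma age_lt j : age j <= j. Proof. exact: occ_le. Qed.

Hypothesis nd_m : forall i, m i <= m i.+1.

Lemma nd_leq i j : i <= j -> m i <= m j.
Proof.
elim: j => [|j IH]; first by rewrite leqn0 => /eqP ->.
by rewrite leq_eqVlt => /predU1P[->//|/IH ij]; exact: leq_trans ij (nd_m j).
Qed.

Lemma ageS j : age j.+1 = if m j.+1 == m j then (age j).+1 else 0.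
Proof.
rewrite /age occS [m j == _]eq_sym; case: eqP => [->|/eqP mj]; first by rewrite addn1.
rewrite addn0 /occ big1// => i _; case: eqP => // mi; exfalso.
move: (nd_m j); rewrite leq_eqVlt eq_sym (negbTE mj) /= -mi ltnNge.
by rewrite nd_leq// ltnW.
Qed.

(** The most recent step comes first, so the current age is the run of [true] at the head and
    appending a step is a [cons]. *)
Fixpoint stays n : seq bool :=
  if n is n'.+1 then (m n == m n') :: stays n' else [::].

Lemma size_stays n : size (stays n) = n.
Proof. by elim: n => //= n ->. Qed.

Lemma count_stays n : count negb (stays n) <= m n.
Proof.
elim: n => //= n IH; case: eqP => [->//|/eqP mn].
rewrite add1n (leq_ltn_trans IH)//.
by rewrite ltn_neqAle eq_sym mn nd_m.
Qed.

End age.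

(** * Run lengths and a lower bound for the variance *)

Section run.
Local Open Scope nat_scope.

Fixpoint run (e : seq bool) : nat :=
  if e is b :: e' then if b then (run e').+1 else 0 else 0.

Fixpoint run_sum (e : seq bool) : nat :=
  if e is b :: e' then run_sum e' + run e else 0.

Fixpoint run_sum_sq (e : seq bool) : nat :=
  if e is b :: e' then run_sum_sq e' + run e ^ 2 else 0.

Lemma run_stays m n : (forall i, m i <= m i.+1) -> run (stays m n) = age m n.
Proof.
move=> nd_m; elim: n => [|n IH]; first by rewrite /age /occ big_ord0.
by rewrite [LHS]/= ageS// IH.
Qed.

Lemma run_sum_sq_stays m n : (forall i, m i <= m i.+1) ->
  run_sum_sq (stays m n) = \sum_(j < n.+1) age m j ^ 2.
Proof.
move=> nd_m; elim: n => [|n IH].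
  by rewrite big_ord1 /age /occ big_ord0.
by rewrite big_ord_recr/= -IH -run_stays.
Qed.

End run.

Section run_bounds.
Context {R : rcfType}.
Implicit Types (e : seq bool) (c d : R).

(* With blocks of lengths l_i, 2 * (sum of the runs) + n is the sum of the l_i^2,
   and l_i^2 >= 2 d l_i - d^2; the last block is kept exact for the induction. *)
Lemma run_sum_ge d e :
  2 * d * ((size e)%:R - (run e)%:R) - (count negb e)%:R * d ^+ 2
  + (run e).+1%:R ^+ 2 <= 2 * (run_sum e)%:R + (size e).+1%:R.
Proof.
elim: e => [|b e IH].
  by rewrite /= expr1n; lra.
have := sqr_ge0 ((run e).+1%:R - d).
case: b => /=; rewrite ?add0n ?add1n ?natrD -!natr1 -?natr1 ?addn0 in IH *.
  by lra.
by lra.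
Qed.

(** The sum of [x^2 >= 2 c x - c^2] over the runs: Cauchy-Schwarz with its parameter left free. *)
Lemma run_sum_sq_ge c e :
  2 * c * (run_sum e)%:R - (size e)%:R * c ^+ 2 <= (run_sum_sq e)%:R.
Proof.
elim: e => [|b e IH]; first by rewrite mulr0 mul0r subr0.
have -> : run_sum (b :: e) = (run_sum e + run (b :: e))%N by [].
have -> : run_sum_sq (b :: e) = (run_sum_sq e + run (b :: e) ^ 2)%N by [].
rewrite /= !natrD natrX -natr1; move: IH (sqr_ge0 ((run (b :: e))%:R - c)).
by lra.
Qed.

(** The two preceding bounds at their best parameters. With [s] the sum of the runs, [c = s / n]
    gives [s^2 <= n y]; with [K] blocks, the mean block length [d = n / K] gives
    [n^2 / K <= 2 s + n]. *)
Lemma inv_count_le e (n : R) : n = (size e).+1%:R ->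
  n ^+ 2 / (count negb e).+1%:R <= n + 2 * Num.sqrt (n * (run_sum_sq e)%:R).
Proof.
move=> nE; set K := (count negb e).+1%:R : R; set y := (run_sum_sq e)%:R : R.
have n0 : 0 < n by rewrite nE ltr0n.
have K0 : 0 < K by rewrite ltr0n.
set s := (run_sum e)%:R : R.
have s0 : 0 <= s by rewrite ler0n.
have y0 : 0 <= y by rewrite ler0n.
have sy : s <= Num.sqrt (n * y).
  rewrite -(ger0_norm s0) -sqrtr_sqr ler_wsqrtr//.
  have := run_sum_sq_ge (s / n) e; rewrite -/s -/y.
  have -> : (size e)%:R = n - 1 by rewrite nE -natr1 addrK.
  move=> h; rewrite -ler_pdivrMl//; apply: le_trans h.
  rewrite -subr_ge0 (_ : _ - _ = (s / n) ^+ 2) ?sqr_ge0//.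
  by field; rewrite gt_eqF.
have := run_sum_ge (n / K) e; rewrite -/s -nE.
have -> : (size e)%:R = n - 1 by rewrite nE -natr1 addrK.
have -> : (count negb e)%:R = K - 1 by rewrite /K -natr1 addrK.
rewrite -natr1; set l := (run e)%:R : R => h.
have : n ^+ 2 / K <= 2 * s + n.
  apply: le_trans h; rewrite -subr_ge0.
  rewrite (_ : _ - _ = (n / K - (l + 1)) ^+ 2) ?sqr_ge0//.
  by field; rewrite gt_eqF.
by move/le_trans; apply; rewrite addrC lerD2l ler_pM2l.
Qed.

End run_bounds.

Section telescope.
Context {R : comNzRingType}.

(** Each value telescopes into the increments that precede its age; exchanging the sums, the weight
    counts how often an increment is used. Dependent values of a piece thus become independent
    increments. *)
Lemma sum_weight (m : nat -> nat) (b : nat -> nat -> R) K n :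
  (forall k, b k 0%N = 0) -> (forall j, (j < n)%N -> (m j < K)%N) ->
  \sum_(j < n) b (m j) (age m j) =
  \sum_(k < K) \sum_(i < n) (weight m n k i)%:R * (b k i.+1 - b k i).
Proof.
move=> b0 mK.
have tel k a : (a <= n)%N ->
    b k a = \sum_(i < n) (i < a)%N%:R * (b k i.+1 - b k i).
  move=> an; rewrite -[LHS]subr0 -[X in _ - X = _](b0 k) -telescope_sumr// big_mkord.
  rewrite (big_ord_widen n (fun i => b k i.+1 - b k i))// big_mkcond/=.
  by apply: eq_bigr => i _; case: ifP => _; rewrite ?mul1r ?mul0r.
transitivity (\sum_(j < n) \sum_(k < K) \sum_(i < n)
    ((m j == k) * (i < age m j))%N%:R * (b k i.+1 - b k i)).
  apply: eq_bigr => j _; rewrite tel; last first.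
    by rewrite (leq_trans (age_lt _ _))// ltnW.
  rewrite (bigD1 (Ordinal (mK j (ltn_ord j))))//= eqxx [X in _ + X]big1 ?addr0.
    by apply: eq_bigr => i _; rewrite mul1n.
  move=> k kj; rewrite big1// => i _; case: eqP => [mjk|_].
    by move/eqP : kj; case; apply: val_inj.
  by rewrite mul0n mul0r.
rewrite exchange_big/=; apply: eq_bigr => k _; rewrite exchange_big/=.
by apply: eq_bigr => i _; rewrite -mulr_suml /weight natr_sum.
Qed.

End telescope.

(** * Moments in the Bernoulli model *)

Section bernoulli.
Context {R : realType}.
Variable q : R.
Hypotheses (q0 : 0 <= q) (q1 : q <= 1).
Implicit Types (Phi Psi : seq bool -> R).

(* Expectation of [Phi] under [n] independent trials of success probability [q];
   the most recent trial is the head of the list. *)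
Fixpoint bern n Phi : R :=
  if n is n'.+1 then
    q * bern n' (fun e => Phi (true :: e)) +
    (1 - q) * bern n' (fun e => Phi (false :: e))
  else Phi [::].

Lemma eq_bern n Phi Psi : (forall e, size e = n -> Phi e = Psi e) ->
  bern n Phi = bern n Psi.
Proof.
elim: n Phi Psi => [|n IH] Phi Psi PP /=; first exact: PP.
by congr (_ * _ + _ * _); apply: IH => e en; apply: PP; rewrite /= en.
Qed.

Lemma bern_le n Phi Psi : (forall e, size e = n -> Phi e <= Psi e) ->
  bern n Phi <= bern n Psi.
Proof.
elim: n Phi Psi => [|n IH] Phi Psi PP /=; first exact: PP.
by apply: lerD; rewrite ler_wpM2l ?subr_ge0//; apply: IH => e en; apply: PP; rewrite /= en.
Qed.

Lemma bernD n Phi Psi :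
  bern n (fun e => Phi e + Psi e) = bern n Phi + bern n Psi.
Proof.
elim: n Phi Psi => [//|n IH] Phi Psi /=.
rewrite (IH (fun e => Phi (true :: e)) (fun e => Psi (true :: e))).
by rewrite (IH (fun e => Phi (false :: e)) (fun e => Psi (false :: e))); ring.
Qed.

Lemma bernZ n c Phi : bern n (fun e => c * Phi e) = c * bern n Phi.
Proof.
elim: n Phi => [//|n IH] Phi /=.
by rewrite (IH (fun e => Phi (true :: e))) (IH (fun e => Phi (false :: e))); ring.
Qed.

Lemma bern_cst n c : bern n (fun=> c) = c.
Proof. by elim: n => [//|n /= ->]; ring. Qed.

Lemma bernS n Phi : bern n.+1 Phi =
  bern n (fun e => q * Phi (true :: e) + (1 - q) * Phi (false :: e)).
Proof. by rewrite bernD !bernZ. Qed.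

(** With [p = 1 - q] the variable is 1 plus a binomial one, of second moment
    [(1 + n p)^2 + n p (1 - p)]; the bound discards the negative term, and each induction step has
    slack [p^2]. *)
Lemma bern_count_sq n :
  bern n (fun e => (count negb e).+1%:R ^+ 2) <=
  (1 + n%:R * (1 - q)) ^+ 2 + n%:R * (1 - q).
Proof.
have k0 : 0 <= 1 - q by rewrite subr_ge0.
have count1 m : bern m (fun e => (count negb e).+1%:R) = 1 + m%:R * (1 - q).
  elim: m => [|m IH]; first by rewrite mul0r addr0.
  rewrite bernS.
  rewrite (@eq_bern _ _ (fun e => (count negb e).+1%:R + (1 - q))).
    by rewrite bernD IH bern_cst -[m.+1%:R]natr1; ring.
  by move=> e _; rewrite /= add0n add1n -[(_.+2)%:R]natr1; ring.
elim: n => [|n IH]; first by rewrite /= !mul0r !addr0.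
rewrite bernS.
rewrite (@eq_bern _ _ (fun e => (count negb e).+1%:R ^+ 2 +
    ((2 * (1 - q)) * (count negb e).+1%:R + (1 - q)))).
  rewrite bernD [X in _ + X]bernD bernZ count1 bern_cst -[n.+1%:R]natr1.
  have := sqr_ge0 (1 - q); move: IH; lra.
by move=> e _; rewrite /= add0n add1n -[(_.+2)%:R]natr1; ring.
Qed.

End bernoulli.

(** * The Poisson equation for the age and the variance of the integrated square *)

Section renewal.
Context {R : realType}.
Variables (r h : R).
Hypotheses (r0 : 0 < r) (h0 : 0 < h) (hr : h <= r^-1).
Local Notation q := (expR (- (r * h))).
Local Notation kappa := (1 - q).
Local Notation alpha := (q * h / kappa).
Local Notation beta := (2 * h * alpha / kappa).

(* The linear rate of growth of [V] below, which tends to 2 / r ^ 2 with the mesh. *)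
Definition mean_rate : R := h * alpha + q * beta.

Lemma q_lt1 : q < 1.
Proof. by rewrite expR_lt1 oppr_lt0 mulr_gt0. Qed.

Lemma kappa_gt0 : 0 < kappa. Proof. by rewrite subr_gt0 q_lt1. Qed.

Lemma kappa_le : kappa <= r * h.
Proof. by have := expR_ge1Dx (- (r * h)); lra. Qed.

Lemma alpha_ge0 : 0 <= alpha.
Proof. by rewrite divr_ge0 ?mulr_ge0 ?expR_ge0 ?ltW ?kappa_gt0. Qed.

Lemma alpha_le : alpha <= r^-1.
Proof.
rewrite ler_pdivrMr ?kappa_gt0// ler_pdivlMl//.
have := expR_ge1Dx (r * h); have := expR_gt0 (r * h).
have : q * expR (r * h) = 1 by rewrite -expRD addNr expR0.
have := expR_gt0 (- (r * h)).
set E := expR (r * h); set Q := expR _ => Q0 QE E0 hE.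
have : Q * (1 + r * h) <= Q * E by rewrite ler_pM2l.
rewrite QE; lra.
Qed.

Lemma h_kappaE : h / kappa = h + alpha.
Proof. by field; rewrite gt_eqF ?kappa_gt0. Qed.

Lemma h_kappa_ge : r^-1 <= h / kappa.
Proof. by rewrite ler_pdivlMr ?kappa_gt0// ler_pdivrMl// kappa_le. Qed.

Lemma h_kappa_le : h / kappa <= r^-1 + h.
Proof. by rewrite h_kappaE addrC lerD2r alpha_le. Qed.

Lemma mean_rateE : mean_rate = q * (1 + q) * (h / kappa) ^+ 2.
Proof. by rewrite /mean_rate; field; rewrite gt_eqF ?kappa_gt0. Qed.

Let X e : R := h * (run e)%:R.
(** The corrector is a quadratic vanishing at 0, the age after a reset, and [k x = h x^2 + g x]. Its
    coefficients come from matching powers of [x] in [q k(x + h) = g x + const]: degree 2 gives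
    [alpha = q (h + alpha)], degree 1 gives [beta = q (2 h (h + alpha) + beta)], and the constant
    left over is [mean_rate * h]. *)
Let g x := alpha * x ^+ 2 + beta * x.
Let k x := (h + alpha) * x ^+ 2 + beta * x.
Let V e : R := h ^+ 3 * (run_sum_sq e)%:R.
(** Here 36 is the square of the 6 in the quadratic bound [6 (r x + 1)^2 / r^3] for [g] and [k], and
    4096 is [8^4], from [z + 1 <= 8 exp (z / 8)] raised to the fourth power. The resulting exponent
    [r x / 2] is the one whose exponential moment is bounded. *)
Definition dev_const : R := 36 * 4096 / r ^+ 6.
Local Notation D := dev_const.

Lemma dev_const_ge0 : 0 <= D.
Proof.
by apply: divr_ge0; [exact: mulr_ge0 (ler0n _ _) (ler0n _ _)|exact: exprn_ge0 (ltW r0)].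
Qed.

(* [V + g X - mean_rate h n] is a martingale: after a step from [x], [k] is the
   increment of [V] plus the new value of [g], in case of survival, and 0 otherwise. *)
Lemma poisson_equation x : q * k (x + h) = g x + mean_rate * h.
Proof. by rewrite /k /g /mean_rate; field; rewrite gt_eqF ?kappa_gt0. Qed.

(* At the exponent r / 2 the recursion is u' = rho u + 1 - rho^2 with rho < 1,
   whose fixed point 1 + rho is at most 2. *)
Lemma bern_expR n : bern q n (fun e => expR (r / 2 * X e)) <= 2.
Proof.
elim: n => [|n IH]; first by rewrite /= /X mulr0 mulr0 expR0 ler1n.
rewrite bernS.
pose rho := expR (- (r * h / 2)).
have qE : q = rho ^+ 2.
  by rewrite /rho -expRM_natl; congr expR; field.
rewrite (@eq_bern _ _ _ _ (fun e => rho * expR (r / 2 * X e) + (1 - q))).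
  rewrite bernD bernZ bern_cst qE.
  have : rho * bern q n (fun e => expR (r / 2 * X e)) <= rho * 2.
    by rewrite ler_pM2l ?expR_gt0.
  have := sqr_ge0 (1 - rho); rewrite -qE; move: qE; lra.
move=> e _; rewrite /= /X /= mulr0 mulr0 expR0 mulr1; congr (_ + _).
rewrite qE -natr1 expr2 -mulrA; congr (_ * _).
by rewrite /rho -expRD; congr expR; field.
Qed.

Lemma poly4_le_expR x : 0 <= x ->
  (6 * (r * x + 1) ^+ 2 / r ^+ 3) ^+ 2 <= D * expR (r / 2 * x).
Proof.
move=> x0; set z := r * x.
have z0 : 0 <= z by rewrite mulr_ge0// ltW.
have h1 : z + 1 <= 8 * expR (z / 8) by have := expR_ge1Dx (z / 8); lra.
have -> : D * expR (r / 2 * x) = (36 / r ^+ 6) * (8 * expR (z / 8)) ^+ 4.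
  rewrite exprMn -expRM_natl (_ : 4%:R * (z / 8) = r / 2 * x); last by rewrite /z; field.
  by rewrite /dev_const; field; rewrite gt_eqF.
have -> : (6 * (z + 1) ^+ 2 / r ^+ 3) ^+ 2 = (36 / r ^+ 6) * (z + 1) ^+ 4.
  by field; rewrite gt_eqF.
rewrite ler_pM2l; last by rewrite divr_gt0// exprn_gt0.
by rewrite lerXn2r// ?nnegrE ?mulr_ge0 ?expR_ge0 ?addr_ge0.
Qed.

Lemma beta_ge0 : 0 <= beta.
Proof.
by rewrite divr_ge0 ?(ltW kappa_gt0)// mulr_ge0 ?alpha_ge0// mulr_ge0// ltW.
Qed.

Lemma beta_le : beta <= 4 / r ^+ 2.
Proof.
have -> : beta = 2 * (alpha * (h / kappa)) by field; rewrite gt_eqF ?kappa_gt0.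
have -> : 4 / r ^+ 2 = 2 * (r^-1 * (2 / r)) by field; rewrite gt_eqF.
rewrite ler_pM2l// ler_pM ?alpha_ge0 ?alpha_le//.
  by rewrite divr_ge0 ?ltW ?kappa_gt0.
by apply: le_trans h_kappa_le _; move: hr; lra.
Qed.

(** With [z = r x + 1 >= 1], a mesh of at most [1 / r] gives [x + h <= z / r] and
    [h / kappa <= 2 / r]. The 6 is 2 + 4, after [z <= z^2]. *)
Lemma k_le x : 0 <= x -> 0 <= k (x + h) <= 6 * (r * x + 1) ^+ 2 / r ^+ 3.
Proof.
move=> x0; have xh : 0 <= x + h by rewrite addr_ge0// ltW.
rewrite /k -h_kappaE; apply/andP; split.
  by apply: addr_ge0; apply: mulr_ge0; rewrite ?sqr_ge0 ?beta_ge0 ?divr_ge0 ?(ltW h0) ?(ltW kappa_gt0).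
set z := r * x + 1.
have z1 : 1 <= z by rewrite lerDr mulr_ge0// ltW.
have xz : x + h <= z / r.
  by rewrite /z mulrDl mul1r mulrAC divff ?gt_eqF// mul1r lerD2l.
have z0 : 0 <= z by apply: le_trans z1.
have zr0 : 0 <= z / r by rewrite divr_ge0// ltW.
have h1 : h / kappa * (x + h) ^+ 2 <= (2 / r) * (z / r) ^+ 2.
  apply: ler_pM; rewrite ?sqr_ge0 ?divr_ge0 ?(ltW h0) ?(ltW kappa_gt0)//.
    by apply: le_trans h_kappa_le _; move: hr; lra.
  by rewrite lerXn2r.
have h2 : beta * (x + h) <= 4 / r ^+ 2 * (z / r).
  by apply: ler_pM; rewrite ?beta_ge0 ?beta_le.
apply: le_trans (lerD h1 h2) _.
have -> : 2 / r * (z / r) ^+ 2 + 4 / r ^+ 2 * (z / r) =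
    (2 * z ^+ 2 + 4 * z) / r ^+ 3 by field; rewrite gt_eqF.
by rewrite ler_pM2r ?invr_gt0 ?exprn_gt0//; nra.
Qed.

Lemma g_le x : 0 <= x -> 0 <= g x <= 6 * (r * x + 1) ^+ 2 / r ^+ 3.
Proof.
move=> x0; apply/andP; split.
  by apply: addr_ge0; apply: mulr_ge0; rewrite ?sqr_ge0 ?beta_ge0 ?alpha_ge0.
apply: le_trans (_ : _ <= r^-1 * x ^+ 2 + 4 / r ^+ 2 * x) _.
  by rewrite lerD ?ler_wpM2r ?sqr_ge0 ?alpha_le ?beta_le.
have -> : r^-1 * x ^+ 2 + 4 / r ^+ 2 * x = ((r * x) ^+ 2 + 4 * (r * x)) / r ^+ 3.
  by field; rewrite gt_eqF.
rewrite ler_pM2r ?invr_gt0 ?exprn_gt0//.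
have : 0 <= r * x by rewrite mulr_ge0// ltW.
nra.
Qed.

(** Orthogonal increments: given the past, the next increment is [k - q k] with probability [q] and
    [- q k] otherwise, so the second moment grows by [q kappa k^2]. Since [kappa <= r h], the total
    is of the order of the elapsed time, whatever the mesh. *)
Lemma bern_martingale n :
  bern q n (fun e => (V e + g (X e) - mean_rate * h * (size e)%:R) ^+ 2) <=
  2 * D * (r * h * n%:R).
Proof.
have X0 e : 0 <= X e by rewrite mulr_ge0// ltW.
elim: n => [|n IH].
  by rewrite /= /V /X /g /= !mulr0 expr0n/= !mulr0 !addr0 subr0 expr0n.
rewrite bernS.
rewrite (@eq_bern _ _ _ _ (fun e =>
    (V e + g (X e) - mean_rate * h * (size e)%:R) ^+ 2 +
    (q * kappa) * k (X e + h) ^+ 2)); last first.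
  move=> e _.
  have -> : V (true :: e) = V e + h * (X e + h) ^+ 2.
    by rewrite /V /X /= natrD natrX -natr1; ring.
  have -> : V (false :: e) = V e by rewrite /V /= addn0.
  have -> : X (true :: e) = X e + h by rewrite /X /= -natr1; ring.
  have -> : X (false :: e) = 0 by rewrite /X /= mulr0.
  have -> : g 0 = 0 by rewrite /g expr0n !mulr0 addr0.
  have -> : g (X e + h) = k (X e + h) - h * (X e + h) ^+ 2 by rewrite /k /g; ring.
  have gE : g (X e) = q * k (X e + h) - mean_rate * h.
    by rewrite poisson_equation addrK.
  rewrite gE /= -natr1; ring.
rewrite bernD bernZ -[n.+1%:R]natr1 (mulrDr (r * h)) (mulrDr (2 * D)) mulr1; apply: lerD; first exact: IH.
apply: le_trans (_ : _ <= q * kappa * (D * 2)) _.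
  rewrite ler_wpM2l ?mulr_ge0 ?expR_ge0 ?(ltW kappa_gt0)//.
  apply: le_trans (_ : _ <= bern q n (fun e => D * expR (r / 2 * X e))) _.
    apply: bern_le => [||e _]; rewrite ?expR_ge0 ?(ltW q_lt1)//.
    apply: le_trans (poly4_le_expR (X0 e)).
    by have /andP[k0 kle] := k_le (X0 e); rewrite lerXn2r ?nnegrE// (le_trans k0).
  by rewrite bernZ ler_wpM2l ?bern_expR ?dev_const_ge0.
have D0 : 0 <= D * 2 by rewrite mulr_ge0 ?dev_const_ge0.
rewrite (_ : 2 * D * (r * h) = r * h * (D * 2)); last by ring.
rewrite ler_wpM2r//; apply: le_trans kappa_le.
by rewrite ler_piMl ?(ltW q_lt1)// ltW// kappa_gt0.
Qed.

(** The corrector [g] is removed by [(u - g)^2 <= 2 u^2 + 2 g^2]; its square has bounded mean, which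
    is the source of the [+ 1]. *)
Lemma bern_V n :
  bern q n (fun e => (V e - mean_rate * h * (size e)%:R) ^+ 2) <=
  4 * D * (r * h * n%:R + 1).
Proof.
have X0 e : 0 <= X e by rewrite mulr_ge0// ltW.
have D0 := dev_const_ge0.
apply: le_trans (_ : _ <= bern q n (fun e =>
    2 * (V e + g (X e) - mean_rate * h * (size e)%:R) ^+ 2 +
    2 * (D * expR (r / 2 * X e)))) _.
  apply: bern_le => [||e _]; rewrite ?expR_ge0 ?(ltW q_lt1)//.
  apply: le_trans (_ : _ <= 2 * (V e + g (X e) - mean_rate * h * (size e)%:R) ^+ 2
     + 2 * g (X e) ^+ 2) _.
    set a := V e; set b := g _; set c := _ * (size e)%:R.
    by have := sqr_ge0 (a + 2 * b - c); lra.
  rewrite lerD2l ler_pM2l//; apply: le_trans (poly4_le_expR (X0 e)).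
  by have /andP[k0 kle] := g_le (X0 e); rewrite lerXn2r ?nnegrE// (le_trans k0).
rewrite bernD !bernZ.
have := bern_martingale n; have := bern_expR n.
set A := bern _ _ _; set B := bern _ _ _ => A2 B2.
have : D * A <= D * 2 by rewrite ler_wpM2l.
by move: B2; lra.
Qed.

End renewal.

(** * Riemann sums along a counting path *)

Section path.
Context {R : realType}.
Implicit Types (s t x : R).
Variables (N : R -> nat) (T : R).
Hypothesis T0 : 0 < T.
Hypothesis ndN : forall s t : R, 0 <= s -> s <= t -> (N s <= N t)%N.
Hypothesis rcN : forall t : R, 0 <= t -> \forall s \near t^'+, N s = N t.
Variable F : nat -> R -> R.
Hypothesis cF : forall k, {within `[0, +oo[, continuous (F k)}.

Definition last_jump (t : R) := inf [set s | 0 <= s /\ N s = N t].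

Definition mesh n := T / n.+1%:R.

(** Right end points of the cells: the first is one mesh width, the last is [T]. Approaching [t]
    from the right is what lets right-continuity identify the skeleton with [N t] for a fine
    mesh. *)
Definition grid n j := j.+1%:R * mesh n.

Definition skel n j := N (grid n j).

(** The second argument of [F] is an age counted on the grid, hence a function of the skeleton
    alone. *)
Definition riemann n := \sum_(j < n.+1) F (skel n j) (mesh n * (age (skel n) j)%:R) * mesh n.

Lemma last_jump_ge0 (t : R) : 0 <= t -> 0 <= last_jump t.
Proof.
move=> t0; apply: lb_le_inf; first by exists t.
by move=> s [].
Qed.

Lemma last_jump_le t s : 0 <= s -> N s = N t -> last_jump t <= s.
Proof. by move=> s0 st; apply: ge_inf => //; exists 0 => ? []. Qed.

(* Right-continuity makes the infimum defining [last_jump] a minimum. *)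
Lemma N_last_jump t s : 0 <= t -> last_jump t <= s -> s <= t -> N s = N t.
Proof.
move=> t0 Ls st.
have L0 := last_jump_ge0 t0.
have NL : N (last_jump t) = N t.
  have [u [Lu uLN]] : exists u, [/\ last_jump t < u & forall v, last_jump t < v < u -> N v = N (last_jump t)].
    have := rcN L0.
    rewrite near_withinE => -[e /= e0 He].
    exists (last_jump t + e); split; first by rewrite ltrDl.
    move=> v /andP[Lv vu]; apply: He => //=.
    by rewrite ltr_distlC; apply/andP; split; [rewrite (le_lt_trans _ Lv)// gerBl ltW|].
  have hinf : has_inf [set s | 0 <= s /\ N s = N t].
    by split; [exists t|exists 0 => ? []].
  have [v [v0 vt] vu] : exists2 v, [set s | 0 <= s /\ N s = N t] v & v < u.
    have := @inf_adherent _ _ (u - last_jump t) _ hinf.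
    rewrite subr_gt0 => /(_ Lu) [v vS]; rewrite addrC subrK => vu.
    by exists v.
  have := last_jump_le v0 vt; rewrite le_eqVlt => /predU1P[->//|Lv].
  by rewrite -vt uLN// Lv vu.
by apply/eqP; rewrite eqn_leq ndN//= ?(le_trans L0)// -NL ndN.
Qed.

Lemma mesh_gt0 n : 0 < mesh n. Proof. by rewrite divr_gt0. Qed.

Lemma mesh_cvg : mesh n @[n --> \oo] --> 0.
Proof.
rewrite -(mulr0 T); apply: cvgMr; exact: cvg_harmonic.
Qed.

Definition cell n (t : R) : nat := Num.trunc (t / mesh n).

Lemma cell_itv n t : 0 <= t ->
  (cell n t)%:R * mesh n <= t < (cell n t).+1%:R * mesh n.
Proof.
move=> t0; have m0 := mesh_gt0 n.
rewrite -ler_pdivlMr// -ltr_pdivrMr// /cell.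
by apply: truncn_itv; rewrite divr_ge0// ltW.
Qed.

Lemma grid_cell_cvg t : 0 <= t -> grid n (cell n t) @[n --> \oo] --> t.
Proof.
move=> t0.
apply: (@squeeze_cvgr _ _ _ _ (fun=> t) (fun n => t + mesh n)).
- near=> n; have /andP[h1 h2] := cell_itv n t0; rewrite /grid ltW//=.
  by rewrite -natr1 mulrDl mul1r lerD2r.
- exact: cvg_cst.
- by rewrite -[X in _ --> X]addr0; apply: cvgD; [exact: cvg_cst|exact: mesh_cvg].
Unshelve. all: by end_near. Qed.

(** The path is constant from its last jump up to [t], so the age counts the grid times in that
    stretch before index [j]. With [i0] the cell of the last jump, this number lies between [j - i0]
    and [j - i0 + 1], and rounding [t] and the jump to their cells accounts for the rest. *)
Lemma age_cell n t : 0 <= t -> skel n (cell n t) = N t ->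
  `|mesh n * (age (skel n) (cell n t))%:R - (t - last_jump t)| <= 2 * mesh n.
Proof.
move=> t0 Nt; have m0 := mesh_gt0 n.
have L0 := last_jump_ge0 t0.
have Lt : last_jump t <= t by exact: last_jump_le.
have /andP[h1 h2] := cell_itv n t0; set j := cell n t in h1 h2 Nt *.
pose i0 := cell n (last_jump t).
have /andP[l1 l2] := cell_itv n L0; rewrite -/i0 in l1 l2.
have i0j : (i0 <= j)%N.
  rewrite -ltnS -(ltr_nat R) -(ltr_pM2r m0).
  by apply: le_lt_trans l1 _; apply: le_lt_trans h2.
have ageE : age (skel n) j = (\sum_(i < j) (last_jump t <= grid n i)%R)%N.
  apply: eq_bigr => i _; rewrite Nt; congr nat_of_bool.
  have it : grid n i <= t by apply: le_trans h1; rewrite ler_pM2r// ler_nat.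
  have i0g : 0 <= grid n i by rewrite mulr_ge0// ltW.
  apply/eqP/idP => [|Lg]; first exact: last_jump_le.
  exact: N_last_jump.
have sum_leq k l : (\sum_(i < l) (k <= i) = l - k)%N.
  elim: l => [|l IH]; first by rewrite big_ord0.
  by rewrite big_ord_recr/= IH; case: (leqP k l) => ?; lia.
have age_ge : (j - i0 <= age (skel n) j)%N.
  rewrite ageE -sum_leq; apply: leq_sum => i _.
  case: (leqP i0 i) => // i0i; suff -> : last_jump t <= grid n i by [].
  by apply: le_trans (ltW l2) _; rewrite ler_pM2r// ler_nat.
(* The predecessor of [i0] is there because a jump exactly on a grid time makes that time count. *)
have age_le : (age (skel n) j <= j - i0.-1)%N.
  rewrite ageE -sum_leq; apply: leq_sum => i _.
  case: (boolP (last_jump t <= grid n i)) => // Lg.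
  suff : (i0 <= i.+1)%N by move=> ?; suff -> : (i0.-1 <= i)%N by []; lia.
  by rewrite -(ler_nat R) -(ler_pM2r m0); exact: le_trans Lg.
have {}age_le : (age (skel n) j)%:R <= j%:R - i0%:R + 1 :> R.
  have : (age (skel n) j + i0 <= j + 1)%N by lia.
  by rewrite -(ler_nat R) !natrD; lra.
have {}age_ge : j%:R - i0%:R <= (age (skel n) j)%:R :> R.
  by rewrite -natrB// ler_nat.
have {}age_ge : mesh n * (j%:R - i0%:R) <= mesh n * (age (skel n) j)%:R by rewrite ler_pM2l.
have {}age_le : mesh n * (age (skel n) j)%:R <= mesh n * (j%:R - i0%:R + 1) by rewrite ler_pM2l.
rewrite -[j.+1%:R]natr1 in h2; rewrite -[i0.+1%:R]natr1 in l2.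
rewrite ler_norml; apply/andP; split; lra.
Qed.

Lemma skel_cell_near t : 0 <= t -> \forall n \near \oo, skel n (cell n t) = N t.
Proof.
move=> t0; have := rcN t0; rewrite near_withinE => -[e /= e0 He].
have /cvgrPdist_lt /(_ _ e0) := grid_cell_cvg t0.
apply: filterS => n tn; apply: He => //=.
by have /andP[] := cell_itv n t0.
Qed.

Lemma age_cell_cvg t : 0 <= t ->
  mesh n * (age (skel n) (cell n t))%:R @[n --> \oo] --> t - last_jump t.
Proof.
move=> t0; apply/cvgrPdist_le => /= e e0.
have e2 : 0 < e / 2 by rewrite divr_gt0.
have /cvgrPdist_lt /(_ _ e2) mesh_lt := mesh_cvg.
near=> n.
rewrite distrC (le_trans (age_cell t0 _))//; first by near: n; exact: skel_cell_near.
suff : `|0 - mesh n| < e / 2 by rewrite sub0r normrN gtr0_norm ?mesh_gt0//; lra.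
by near: n.
Unshelve. all: by end_near. Qed.

Lemma cell_le n t : 0 <= t -> t < T -> (cell n t <= n)%N.
Proof.
move=> t0 tT; have m0 := mesh_gt0 n.
have /andP[h1 _] := cell_itv n t0.
rewrite -ltnS -(ltr_nat R) -(ltr_pM2r m0); apply: le_lt_trans h1 _.
by rewrite /mesh mulrCA divff ?mulr1// pnatr_eq0.
Qed.

Definition step n t := F (skel n (cell n t)) (mesh n * (age (skel n) (cell n t))%:R).

(** The same step function as a finite sum of indicators, from which its measurability and its
    integral are read off. *)
Definition stepI n t := \sum_(j < n.+1) F (skel n j) (mesh n * (age (skel n) j)%:R) *
  \1_(`[j%:R * mesh n, j.+1%:R * mesh n[%classic : set R) t.

Lemma stepE n t : 0 <= t -> t < T -> step n t = stepI n t.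
Proof.
move=> t0 tT; have m0 := mesh_gt0 n.
have /andP[h1 h2] := cell_itv n t0.
rewrite /stepI (bigD1 (Ordinal (cell_le n t0 tT : (cell n t < n.+1)%N)))//= indicE mem_set/=; last first.
  by rewrite in_itv/= h1 h2.
rewrite mulr1 big1 ?addr0// => j jc; rewrite indicE memNset ?mulr0//=.
rewrite in_itv/= => /andP[j1 j2]; move/eqP : jc; apply; apply: val_inj => /=.
have nat_lt (a b : nat) : a%:R * mesh n < b%:R * mesh n -> (a < b)%N.
  by rewrite ltr_pM2r// ltr_nat.
apply/eqP; rewrite eqn_leq; apply/andP; split; rewrite -ltnS; apply: nat_lt.
  exact: le_lt_trans h2.
exact: le_lt_trans j2.
Qed.

Lemma measurable_stepI n (D : set R) : measurable_fun D (stepI n).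
Proof.
by apply: measurable_sum => j; apply: measurable_funM.
Qed.

Let mu := @lebesgue_measure R.

Lemma integral_stepI n : (\int[mu]_(t in `[0%R, T[) (stepI n t)%:E = (riemann n)%:E)%E.
Proof.
have m0 := mesh_gt0 n.
pose c j := F (skel n j) (mesh n * (age (skel n) j)%:R).
pose I j : set R := `[j%:R * mesh n, j.+1%:R * mesh n[%classic.
transitivity (\int[mu]_(t in `[0%R, T[)
    \sum_(j < n.+1) ((c j)%:E * (\1_(I j) t)%:E))%E.
  by apply: eq_integral => t _; rewrite -sumEFin.
have intI j : mu.-integrable `[0%R, T[ (fun t => (\1_(I j) t)%:E).
  by apply: (integrableS measurableT) => //; exact: integrable_indic_itv.
rewrite integral_sum//; last by move=> j; exact: integrableZl.
rewrite -sumEFin; apply: eq_bigr => j _.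
rewrite integralZl//.
rewrite integral_indic//; last exact: measurable_itv.
rewrite setIidl; last first.
  move=> t; rewrite /I/= !in_itv/= => /andP[h1 h2]; apply/andP; split.
    by apply: le_trans h1; rewrite mulr_ge0// ltW.
  apply: lt_le_trans h2 _.
  rewrite [leRHS](_ : T = n.+1%:R * mesh n); last by rewrite /mesh mulrCA divff ?mulr1// pnatr_eq0.
  by rewrite ler_pM2r// ler_nat.
rewrite [RHS]EFinM; congr (_ * _)%E.
change (lebesgue_measure (I j) = (mesh n)%:E).
rewrite lebesgue_measure_itv/= lte_fin ltr_pM2r// ltr_nat leqnn -EFinB -mulrBl.
by rewrite -natrB// subSnn mul1r.
Qed.

(** Only the levels up to [N T] occur, and each [F k] is bounded on the compact interval; this is
    the dominating constant for the step functions. *)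
Lemma path_bound : exists M : R, forall k x, (k <= N T)%N -> 0 <= x <= T -> `|F k x| <= M.
Proof.
have cFT k : {within `[0, T], continuous (F k)}.
  apply: continuous_subspaceW (@cF k) => x /=; rewrite !in_itv/= => /andP[-> _]//.
have /choice[M HM] : forall k, exists M, forall x, 0 <= x <= T -> `|F k x| <= M.
  move=> k.
  have [a aT Ha] := EVT_max (ltW T0) (cFT k).
  have [b bT Hb] := EVT_min (ltW T0) (cFT k).
  exists (Num.max `|F k a| `|F k b|) => x xT.
  have /Ha h1 : x \in `[0, T] by rewrite in_itv.
  have /Hb h2 : x \in `[0, T] by rewrite in_itv.
  rewrite le_max; case: (leP 0 (F k x)) => Fx.
    by rewrite ger0_norm// (le_trans h1)// ler_norm.
  rewrite ltr0_norm// -(normrN (F k b)); apply/orP; right.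
  by apply: le_trans (ler_norm _); rewrite lerN2.
exists (\sum_(k < (N T).+1) `|M k|) => k x kN xT.
rewrite (bigD1 (Ordinal (kN : (k < (N T).+1)%N)))//= -[leLHS]addr0 lerD ?sumr_ge0//.
by rewrite (le_trans (HM k x xT))// ler_norm.
Qed.

Lemma step_cvg t : 0 <= t ->
  step n t @[n --> \oo] --> F (N t) (t - last_jump t).
Proof.
move=> t0.
have A0 : 0 <= t - last_jump t by rewrite subr_ge0 last_jump_le.
have /cvgrPdist_lt Fcvg : F (N t) x @[x --> within `[0, +oo[ (nbhs (t - last_jump t))] -->
    F (N t) (t - last_jump t).
  have := @cF (N t); move/subspace_continuousP; apply.
  by rewrite /= in_itv/= A0.
apply/cvgrPdist_lt => e e0.
have := Fcvg _ e0; rewrite near_withinE => /nbhs_ballP[d /= d0 Hd].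
have /cvgrPdist_lt /(_ _ d0) ad := age_cell_cvg t0.
near=> n.
rewrite /step (_ : skel n (cell n t) = N t); last by near: n; exact: skel_cell_near.
apply: Hd; first by near: n.
by rewrite in_itv/= andbT mulr_ge0// ltW// mesh_gt0.
Unshelve. all: by end_near. Qed.

Lemma riemann_cvg :
  riemann n @[n --> \oo] -->
  (\int[mu]_(t in `[0, T]) F (N t) (t - last_jump t))%R.
Proof.
have [M HM] := path_bound.
have stepI_cvg t : `[0, T[%classic t -> stepI n t @[n --> \oo] --> F (N t) (t - last_jump t).
  rewrite /= in_itv/= => /andP[t0 tT].
  have := step_cvg t0; under eq_cvg do rewrite stepE//.
  exact.
have mf : measurable_fun `[0, T[ (fun t => F (N t) (t - last_jump t)).
  apply: (@measurable_fun_cvg _ _ _ _ stepI) => //.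
  by move=> n; exact: measurable_stepI.
have stepIM n t : `[0, T[%classic t -> `|stepI n t| <= M.
  rewrite /= in_itv/= => /andP[t0 tT]; rewrite -stepE// /step.
  have m0 := mesh_gt0 n.
  have nT : n.+1%:R * mesh n = T by rewrite /mesh mulrCA divff ?mulr1// pnatr_eq0.
  apply: HM.
    apply: ndN; first by rewrite mulr_ge0// ltW.
    by rewrite -[leRHS]nT ler_pM2r// ler_nat ltnS cell_le.
  apply/andP; split; first by rewrite mulr_ge0// ltW.
  rewrite mulrC -nT ler_pM2r// ler_nat (leq_trans (age_lt _ _))// leqW//.
  exact: cell_le.
have fin_itv : (mu `[0%R, T[ < +oo)%E.
  by rewrite /mu lebesgue_measure_itv/= lte_fin T0 -EFinB ltry.
have [] := @dominated_convergence _ _ _ mu `[0%R, T[%classic (measurable_itv _)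
  (fun n t => (stepI n t)%:E) (fun t => (F (N t) (t - last_jump t))%:E) (cst M%:E).
- by move=> n; apply/measurable_EFinP; exact: measurable_stepI.
- exact/measurable_EFinP.
- apply: aeW => t tT; apply/fine_cvgP; split; first exact: nearW.
  exact: stepI_cvg.
- apply/integrableP; split => //.
  by rewrite integral_cst//= lte_mul_pinfty//.
- by apply: aeW => t n tT; rewrite lee_fin; exact: stepIM.
move=> int_f _ /= int_cvg.
have fin_f : (\int[mu]_(x in `[0%R, T[) (F (N x) (x - last_jump x))%:E)%E \is a fin_num.
  exact: integrable_fin_num.
have {}int_cvg : (riemann n)%:E @[n --> \oo] -->
    (fine (\int[mu]_(x in `[0%R, T[) (F (N x) (x - last_jump x))%:E)%E)%:E.
  by rewrite fineK//; under eq_cvg do rewrite -integral_stepI.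
move/fine_cvgP : int_cvg => [_].
rewrite /Rintegral -integral_itv_bndo_bndc//.
exact/measurable_EFinP.
Qed.

End path.

(** * Reset Brownian motion on a grid *)

Section sigma_process.
Context d (Omega : measurableType d) (R : realType) d' (T : measurableType d').
Variable X : R -> Omega -> T.

Lemma sigma_process_bigI (I : Type) (s : seq I) (A : I -> set Omega) :
  (forall i, sigma_process X (A i)) -> sigma_process X (\big[setI/setT]_(i <- s) A i).
Proof.
move=> XA; rewrite /sigma_process.
set G := (\bigcup_(t in _) _).
elim/big_ind : _ => [||i _]; last exact: XA.
  exact: (@measurableT _ (g_sigma_algebraType G)).
exact: (@measurableI _ (g_sigma_algebraType G)).
Qed.

Lemma sigma_process_preimage t (A : set T) : 0 <= t -> measurable A ->
  sigma_process X (X t @^-1` A).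
Proof.
move=> t0 mA; apply: sub_sigma_algebra; exists t; first by rewrite /= in_itv/= t0.
by exists A => //; rewrite setTI.
Qed.

End sigma_process.

Lemma sigma_process_increment d (Omega : measurableType d) (R : realType)
    (X : R -> Omega -> R) s t (A : set R) : 0 <= s -> 0 <= t -> measurable A ->
  sigma_process X ((fun w => X t w - X s w) @^-1` A).
Proof.
move=> s0 t0 mA; rewrite /sigma_process.
set G := (\bigcup_(t in _) _).
have mX u : 0 <= u -> measurable_fun setT (X u : g_sigma_algebraType G -> R).
  move=> u0 _ C mC; rewrite setTI.
  exact: (@sigma_process_preimage _ _ _ _ _ X).
have := measurable_funB (mX _ t0) (mX _ s0).
by move=> /(_ measurableT A mA); rewrite setTI.
Qed.

Lemma age_ext m1 m2 j : (forall i, (i <= j)%N -> m1 i = m2 i) -> age m1 j = age m2 j.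
Proof.
move=> m12; rewrite /age /occ m12//; apply: eq_bigr => i _.
by rewrite m12// ltnW.
Qed.

Lemma measurable_nat_comp d (Omega : measurableType d) d' (T : measurableType d')
    (X : Omega -> nat) (f : nat -> Omega -> T) :
  (forall k, measurable (X @^-1` [set k])) ->
  (forall k, measurable_fun setT (f k)) ->
  measurable_fun setT (fun w => f (X w) w).
Proof.
move=> mX mf _ A mA; rewrite setTI.
rewrite (_ : _ @^-1` _ = \bigcup_k (X @^-1` [set k] `&` f k @^-1` A)).
  apply: bigcup_measurable => k _; apply: measurableI => //.
  by rewrite -[X in measurable X]setTI; exact: mf.
apply/seteqP; split=> w /=; first by move=> ?; exists (X w).
by move=> [k _ [/= <-]].
Qed.

Lemma ge0_integral_mrestr d (Omega : measurableType d) (R : realType)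
    (P : {measure set Omega -> \bar R}) (F : set Omega) (mF : measurable F)
    (f : Omega -> \bar R) :
  measurable_fun setT f -> (forall w, 0 <= f w)%E ->
  (\int[mrestr P mF]_w f w = \int[P]_(w in F) f w)%E.
Proof.
move=> mf f0; rewrite (@integral_density _ _ _ P _ (\1_F))//; last first.
  by move=> A mA; rewrite integral_indic// /mrestr/= setIC.
rewrite [RHS]integral_mkcond; apply: eq_integral => w _.
by rewrite patchE indicE; case: ifP => _; rewrite ?mule1 ?mule0.
Qed.

Section grid_law.
Context d (Omega : measurableType d) (R : realType) (P : probability Omega R).
Variables (r : R) (N : R -> {RV P >-> nat}) (B : nat -> R -> {RV P >-> R}).
Hypotheses (r0 : 0 < r) (HN : is_poisson_process r N)
  (HB : forall n, is_brownian_motion (B n)) (HI : independent_pieces N B).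
Variables (T : R) (n : nat).
Hypothesis T0 : 0 < T.
Local Notation h := (mesh T n).
Let h0 : 0 < h := mesh_gt0 T0 n.

Definition pathN (w : Omega) (t : R) : nat := N t w.

Local Notation m w := (skel (pathN w) T n).

Definition grid_area (w : Omega) : R :=
  riemann (pathN w) T (fun k x => B k x w) n.

Definition grid_var (w : Omega) : R :=
  riemann (pathN w) T (fun k x => x ^+ 2) n.

Definition grid_incr (ki : nat * nat) (w : Omega) : R :=
  B ki.1 (ki.2.+1%:R * h) w - B ki.1 (ki.2%:R * h) w.

Definition pairs K := [seq (k, i) | k <- iota 0 K, i <- iota 0 n.+1].

Lemma measurable_grid_incr ki : measurable_fun setT (grid_incr ki).
Proof. exact: measurable_funB. Qed.

Lemma grid_incr_law ki A : measurable A ->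
  P (grid_incr ki @^-1` A) = gauss_law h A.
Proof.
move=> mA; have [_ _ _ +] := HB ki.1.
move=> /(_ (ki.2%:R * h) (ki.2.+1%:R * h)) => /(_ _ _ A mA).
rewrite /pushforward => ->.
- have -> : gauss_law h A = normal_prob 0 (Num.sqrt h) A by exact: gauss_lawE.
  have -> : ki.2.+1%:R * h - ki.2%:R * h = h.
    by rewrite -mulrBl -natrB// subSnn mul1r.
  by [].
- by rewrite mulr_ge0// ltW.
- by rewrite ltr_pM2r// ltr_nat.
Qed.

(** Two layers of independence: first between the Poisson process and the pieces, grouping all
    increments of a piece in one event, then between the increments within a piece. *)
Lemma grid_incr_indep K (F : set Omega) (A : nat * nat -> set R) :
  sigma_process N F -> (forall ki, measurable (A ki)) ->
  (P (F `&` \big[setI/setT]_(ki <- pairs K) (grid_incr ki @^-1` A ki)) =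
   P F * \prod_(ki <- pairs K) gauss_law h (A ki))%E.
Proof.
move=> NF mA; rewrite !big_allpairs.
pose C (o : option nat) := if o is Some k then
  \big[setI/setT]_(i <- iota 0 n.+1) (grid_incr (k, i) @^-1` A (k, i)) else F.
have := @mutually_independent_seq _ _ _ P _ _ (None :: map Some (iota 0 K)) C HI.
rewrite !big_cons !big_map/= => ->.
- congr (_ * _)%E; apply: eq_bigr => k _.
  have [_ _ ind _] := HB k.
  have nd : {homo (fun i : nat => i%:R * h) : a b / (a <= b)%N >-> a <= b}.
    by move=> a b ab; rewrite ler_pM2r// ler_nat.
  have := ind (fun i => i%:R * h); rewrite mul0r lexx => /(_ isT nd) ind1.
  rewrite (mutually_independent_seq ind1 (iota_uniq 0 n.+1)).
    by apply: eq_bigr => i _; exact: grid_incr_law.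
  by move=> i _; exists (A (k, i)) => //; rewrite setTI.
- apply/andP; split; first by apply/mapP => -[].
  rewrite map_inj_uniq ?iota_uniq// => x y [//].
- move=> [k|] _ //=; apply: sigma_process_bigI => i.
  by apply: sigma_process_increment => //; rewrite mulr_ge0// ltW.
Qed.

(* The values of N on the grid, as one natural number. *)
Definition code (w : Omega) : nat := choice.pickle (mkseq (m w) n.+1).

Definition decode (c : nat) (j : nat) : nat := nth 0%N (odflt [::] (choice.unpickle c)) j.

Lemma decodeK w j : (j < n.+1)%N -> decode (code w) j = m w j.
Proof. by move=> jn; rewrite /decode /code choice.pickleK/= nth_mkseq. Qed.

Lemma age_decode w j : (j < n.+1)%N -> age (decode (code w)) j = age (m w) j.
Proof. by move=> jn; apply: age_ext => i ij; rewrite decodeK// (leq_ltn_trans ij). Qed.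

Lemma code_sigma c : sigma_process N (code @^-1` [set c]).
Proof.
have [[w0 <-]|cN] := pselect (exists w0, code w0 = c); last first.
  rewrite (_ : _ @^-1` _ = N 0 @^-1` set0).
    exact: sigma_process_preimage.
  by rewrite preimage_set0 -subset0 => w /= wc; apply: cN; exists w.
rewrite (_ : _ @^-1` _ =
    \big[setI/setT]_(j < n.+1) (N (grid T n j) @^-1` [set m w0 j])).
  apply: sigma_process_bigI => j; apply: sigma_process_preimage => //.
  by rewrite mulr_ge0// ltW.
rewrite -(bigcap_mkord n.+1 (fun j => N (grid T n j) @^-1` [set m w0 j])).
apply/seteqP; split=> w /=; last first.
  move=> Nw; rewrite /code; congr choice.pickle; apply/eq_in_map => j.
  by rewrite mem_iota/= => jn; exact: Nw.
move=> ww0 j jn; change (m w j = m w0 j).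
by rewrite -(decodeK w jn) ww0 decodeK.
Qed.

Definition code_area c w := \sum_(j < n.+1)
  B (decode c j) (h * (age (decode c) j)%:R) w * h.

Definition code_var c : R := \sum_(j < n.+1) (h * (age (decode c) j)%:R) ^+ 2 * h.

Lemma grid_areaE w : grid_area w = code_area (code w) w.
Proof. by apply: eq_bigr => j _; rewrite decodeK// age_decode. Qed.

Lemma grid_varE w : grid_var w = code_var (code w).
Proof. by apply: eq_bigr => j _; rewrite age_decode. Qed.

Let K c := (\sum_(j < n.+1) decode c j).+1.

Let decode_lt c j : (j < n.+1)%N -> (decode c j < K c)%N.
Proof.
by move=> jn; rewrite ltnS (bigD1 (Ordinal jn))//= leq_addr.
Qed.

(** Once the code is fixed the area is a linear combination of independent increments with
    deterministic coefficients, hence Gaussian. *)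
Lemma code_areaE c w : code_area c w = \sum_(ki <- pairs (K c))
  (h * (weight (decode c) n.+1 ki.1 ki.2)%:R) * grid_incr ki w.
Proof.
rewrite /code_area -mulr_suml.
under eq_bigr do rewrite mulrC.
rewrite (@sum_weight _ (decode c) (fun k a => B k (a%:R * h) w) (K c)); first last.
- by move=> j; exact: decode_lt.
- by move=> k; rewrite mul0r; have [-> _ _ _] := HB k.
rewrite big_allpairs mulrC mulr_sumr.
have bm u (f : nat -> R) : \sum_(i <- iota 0 u) f i = \sum_(i < u) f i.
  by rewrite -{1}(subn0 u) -/(index_iota 0 u) big_mkord.
rewrite bm; apply: eq_bigr => k _; rewrite bm mulr_sumr.
by apply: eq_bigr => i _; rewrite mulrA.
Qed.

Lemma code_varE c : code_var c = \sum_(ki <- pairs (K c))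
  (h * (weight (decode c) n.+1 ki.1 ki.2)%:R) ^+ 2 * h.
Proof.
have bm u (f : nat -> R) : \sum_(i <- iota 0 u) f i = \sum_(i < u) f i.
  by rewrite -{1}(subn0 u) -/(index_iota 0 u) big_mkord.
rewrite big_allpairs bm /code_var.
under eq_bigr do rewrite exprMn mulrAC -natrX.
rewrite -mulr_sumr -natr_sum -(@sum_weight_sq (decode c) (K c)); last first.
  by move=> j; exact: decode_lt.
rewrite natr_sum mulr_sumr; apply: eq_bigr => k _.
rewrite bm natr_sum mulr_sumr; apply: eq_bigr => i _.
by rewrite natrX; ring.
Qed.

Lemma measurable_code c : measurable (code @^-1` [set c]).
Proof.
have sub : sigma_process N `<=` measurable.
  apply: smallest_sub; first exact: sigma_algebra_measurable.
  by move=> A [t _ [C mC <-]]; exact: measurable_funP.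
exact: sub (code_sigma c).
Qed.

Lemma measurable_grid_area : measurable_fun setT grid_area.
Proof.
rewrite (_ : grid_area = fun w => code_area (code w) w); last first.
  by apply/funext => w; exact: grid_areaE.
apply: measurable_nat_comp; first exact: measurable_code.
by move=> c; apply: measurable_sum => j; exact: measurable_funM.
Qed.

Lemma measurable_comp_code d' (U : measurableType d') (g : nat -> U) :
  measurable_fun setT (fun w => g (code w)).
Proof.
by apply: (@measurable_nat_comp _ _ _ _ code (fun c _ => g c)) => // c; exact: measurable_code.
Qed.

Lemma measurable_comp_grid_var d' (U : measurableType d') (g : R -> U) :
  measurable_fun setT (fun w => g (grid_var w)).
Proof.
rewrite (_ : (fun _ => _) = fun w => g (code_var (code w))); last first.
  by apply/funext => w; rewrite grid_varE.
exact: (@measurable_comp_code _ _ (fun c => g (code_var c))).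
Qed.

(** The conditional law given the grid values of [N], multiplied out so that codes of probability 0
    are included. *)
Lemma grid_area_law c A : measurable A ->
  (P (code @^-1` [set c] `&` grid_area @^-1` A) =
   P (code @^-1` [set c]) * gauss_law (code_var c) A)%E.
Proof.
move=> mA.
have -> : code @^-1` [set c] `&` grid_area @^-1` A = code @^-1` [set c] `&`
   (fun w => \sum_(ki <- pairs (K c))
     (h * (weight (decode c) n.+1 ki.1 ki.2)%:R) * grid_incr ki w) @^-1` A.
  by apply/seteqP; split=> w /= [wc]; rewrite grid_areaE wc code_areaE.
rewrite code_varE.
apply: (@gauss_law_bigsum _ _ _ _ _ _ _ _ (fun=> h)) => //.
- by apply: allpairs_uniq; rewrite ?iota_uniq// => -[? ?] [? ?].
- exact: measurable_code.
- exact: measurable_grid_incr.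
- by move=> _; exact: ltW.
- by move=> i; rewrite mulr_ge0// ltW.
- by move=> A' mA'; apply: grid_incr_indep => //; exact: code_sigma.
Qed.

Lemma grid_area_mixture (f : R -> R) : measurable_fun setT f -> (forall x, 0 <= f x) ->
  (\int[P]_w (f (grid_area w))%:E =
   \int[P]_w \int[gauss_law (grid_var w)]_z (f z)%:E)%E.
Proof.
move=> mf f0.
have mfE : measurable_fun setT (EFin \o f) by exact/measurable_EFinP.
have mfS : measurable_fun setT (fun w => (f (grid_area w))%:E).
  apply/measurable_EFinP; apply: measurableT_comp => //; exact: measurable_grid_area.
pose G v : \bar R := (\int[gauss_law v]_z (f z)%:E)%E.
have mG : measurable_fun setT (fun w => G (grid_var w)) by exact: measurable_comp_grid_var.
have G0 v : (0 <= G v)%E by apply: integral_ge0 => x _; rewrite lee_fin.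
have cover : \bigcup_c (code @^-1` [set c]) = setT.
  by rewrite -subTset => w _; exists (code w).
have triv : trivIset setT (fun c => code @^-1` [set c]).
  by move=> c1 c2 _ _ [w [/= -> ->]].
rewrite -cover ge0_integral_bigcup//; first last.
- by move=> w _; rewrite lee_fin.
- by rewrite cover.
- exact: measurable_code.
rewrite ge0_integral_bigcup//; first last.
- by move=> w _; exact: G0.
- by rewrite cover.
- exact: measurable_code.
apply: eq_eseriesr => c _.
have mc := measurable_code c.
rewrite -ge0_integral_mrestr//; last by move=> w; rewrite lee_fin.
have PE : (0 <= fine (P (code @^-1` [set c])))%R by rewrite fine_ge0.
pose p := NngNum PE.
have pE : p%:num%:E = P (code @^-1` [set c]).
  by rewrite /= fineK// fin_num_measure.
pose S : Omega -> measurableTypeR R := grid_area.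
have mS : measurable_fun setT S by exact: measurable_grid_area.
transitivity (\int[pushforward (mrestr P mc) S]_z (f z)%:E)%E.
  rewrite ge0_integral_pushforward ?preimage_setT//.
  by move=> x _; rewrite lee_fin.
transitivity (\int[mscale p (gauss_law (code_var c))]_z (f z)%:E)%E.
  apply: (@eq_measure_integral _ (measurableTypeR R) _ setT
    (mscale p (gauss_law (code_var c)))
    (pushforward (mrestr P mc) (mfun_Sub (mem_set mS)))) => A mA _.
  rewrite /= /pushforward /mrestr /mscale/= setIC grid_area_law//.
  by rewrite -pE.
rewrite ge0_integral_mscale//; last by move=> x _; rewrite lee_fin.
rewrite pE.
transitivity (\int[P]_(w in code @^-1` [set c]) cst (G (code_var c)) w)%E.
  by rewrite integral_cst// muleC.
by apply: eq_integral => w /[!inE]/= wc; rewrite /= /G grid_varE wc.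
Qed.

End grid_law.

(** * The Poisson process on the grid as Bernoulli trials *)

Section grid_bern.
Context d (Omega : measurableType d) (R : realType) (P : probability Omega R).
Variables (r : R) (N : R -> {RV P >-> nat}).
Hypotheses (r0 : 0 < r) (HN : is_poisson_process r N).
Variables (T : R) (n : nat).
Hypothesis T0 : 0 < T.
Local Notation h := (mesh T n).
Let h0 : 0 < h := mesh_gt0 T0 n.
Local Notation m w := (skel (pathN N w) T n).
Local Notation q := (expR (- (r * h))).

Lemma nd_skel w i : (m w i <= m w i.+1)%N.
Proof.
have [_ nd _ _ _] := HN; apply: nd; first by rewrite mulr_ge0// ltW.
by rewrite ler_pM2r// ler_nat.
Qed.

Definition stay_event i (b : bool) : set Omega := [set w | (m w i.+1 == m w i) = b].

Lemma stay_eventE i b : stay_event i b =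
  (fun w => N (grid T n i.+1) w - N (grid T n i) w)%N @^-1` [set k | (k == 0%N) = b].
Proof.
apply/seteqP; split=> w /=; rewrite /stay_event/= => <-; last first.
  by rewrite subn_eq0 eqn_leq nd_skel andbT.
by rewrite subn_eq0 eqn_leq [X in _ && X]nd_skel andbT.
Qed.

Lemma measurable_stay_event i b : measurable (stay_event i b).
Proof.
rewrite stay_eventE -[X in measurable X]setTI.
by apply: measurable_fun_subn.
Qed.

Lemma stay_event_law i b : P (stay_event i b) = (if b then q else 1 - q)%:E.
Proof.
have stayT : P (stay_event i true) = q%:E.
  have [_ _ _ _ law] := HN; rewrite stay_eventE.
  have i0 : 0 <= grid T n i by rewrite mulr_ge0// ltW.
  have ii : grid T n i < grid T n i.+1 by rewrite ltr_pM2r// ltr_nat.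
  have := law _ _ i0 ii [set k | (k == 0%N) = true].
  rewrite /pushforward => ->//.
  rewrite (_ : grid T n i.+1 - grid T n i = h); last first.
    by rewrite /grid -mulrBl -natrB// subSnn mul1r.
  rewrite /poisson_prob mulr_gt0//.
  rewrite (_ : [set _ | _] = [set 0%N]); last first.
    by apply/seteqP; split=> k /=; [move/eqP|move=> ->].
  rewrite esum_set1 ?lee_fin ?poisson_pmf_ge0//.
  by rewrite /poisson_pmf mulr_gt0// expr0 fact0 invr1 !mul1r.
case: b => //.
rewrite (_ : stay_event i false = ~` stay_event i true); last first.
  by apply/seteqP; split=> w; rewrite /stay_event/=; case: (_ == _).
by rewrite probability_setC ?stayT//; exact: measurable_stay_event.
Qed.

Lemma stay_events_law (s : seq nat) (b : nat -> bool) : uniq s ->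
  (P (\big[setI/setT]_(i <- s) stay_event i (b i)) = \prod_(i <- s) P (stay_event i (b i)))%E.
Proof.
move=> us; have [_ _ _ ind _] := HN.
have g0 : 0 <= grid T n 0 by rewrite mulr_ge0// ltW.
have nd : {homo grid T n : m n / (m <= n)%N >-> m <= n}.
  by move=> i j ij; rewrite ler_pM2r// ler_nat.
apply: (mutually_independent_seq (ind _ g0 nd)) => // i _.
exists [set k | (k == 0%N) = b i] => //.
by rewrite setTI -stay_eventE.
Qed.

Lemma measurable_stays k d' (U : measurableType d') (Phi : seq bool -> U) :
  measurable_fun setT (fun w => Phi (stays (m w) k)).
Proof.
elim: k Phi => [|k IH] Phi /=; first exact: measurable_cst.
move=> _ A mA; rewrite setTI.
rewrite (_ : _ @^-1` _ =
  (stay_event k true `&` (fun w => Phi (true :: stays (m w) k)) @^-1` A) `|`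
  (stay_event k false `&` (fun w => Phi (false :: stays (m w) k)) @^-1` A)).
  have mPhi c : measurable ((fun w => Phi (c :: stays (m w) k)) @^-1` A).
    by have := IH (fun e => Phi (c :: e)) measurableT A mA; rewrite setTI.
  by apply: measurableU; apply: measurableI => //; exact: measurable_stay_event.
apply/seteqP; split=> w /=; rewrite /stay_event/=.
  by case: (_ == _); [left|right].
by case=> -[->].
Qed.

(** The induction peels off the latest of the first [k] steps and adds its outcome to the events
    already imposed on later steps; this is why a list [s] of indices at least [k] is carried
    along. *)
Lemma integral_stays_events k (s : seq nat) (b : nat -> bool) (Phi : seq bool -> R) :
  uniq s -> {in s, forall i, (k <= i)%N} -> (forall e, 0 <= Phi e) ->
  (\int[P]_(w in \big[setI/setT]_(i <- s) stay_event i (b i)) (Phi (stays (m w) k))%:E =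
   P (\big[setI/setT]_(i <- s) stay_event i (b i)) * (bern q k Phi)%:E)%E.
Proof.
elim: k s b Phi => [|k IH] s b Phi us ks Phi0.
  rewrite /= integral_cst 1?muleC//; apply: bigsetI_measurable => i; exact: measurable_stay_event.
have kNs : k \notin s by apply/negP => /ks; rewrite ltnn.
set E := \big[setI/setT]_(i <- s) _.
pose b' c i := if i == k then c else b i.
have E'E c : \big[setI/setT]_(i <- k :: s) stay_event i (b' c i) = stay_event k c `&` E.
  rewrite big_cons /b' eqxx; congr (_ `&` _); apply: eq_big_seq => i is_.
  by case: eqP => // ik; move: kNs; rewrite -ik is_.
have us' : uniq (k :: s) by rewrite /= kNs.
have ks' : {in k :: s, forall i, (k <= i)%N}.
  by move=> i; rewrite inE => /predU1P[->//|/ks]; exact: ltnW.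
have PE' c : P (stay_event k c `&` E) = ((if c then q else 1 - q)%:E * P E)%E.
  rewrite -E'E stay_events_law// big_cons {1}/b' eqxx stay_event_law; congr (_ * _)%E.
  rewrite stay_events_law//; apply: eq_big_seq => i is_.
  by rewrite /b'; case: eqP => // ik; move: kNs; rewrite -ik is_.
have mE : measurable E by apply: bigsetI_measurable => i; exact: measurable_stay_event.
have mS c := measurable_stay_event k c.
have EU : E = (stay_event k true `&` E) `|` (stay_event k false `&` E).
  by rewrite -setIUl (_ : _ `|` _ = setT) ?setTI//; apply/seteqP; split=> w //= _;
    rewrite /stay_event/=; case: (_ == _); [left|right].
rewrite {1}EU ge0_integral_setU//; first last.
- rewrite disj_set2E; apply/eqP; rewrite -subset0 => w [[/= w1 _] [w2 _]].
  by move: w2; rewrite /stay_event/= w1.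
- by move=> w _; rewrite lee_fin.
- apply/measurable_EFinP; apply: measurable_funTS.
  exact: (@measurable_stays k.+1 _ R).
- exact: measurableI.
- exact: measurableI.
have step c : (\int[P]_(w in stay_event k c `&` E) (Phi (stays (m w) k.+1))%:E =
    P (stay_event k c `&` E) * (bern q k (fun e => Phi (c :: e)))%:E)%E.
  rewrite -[in RHS]E'E -IH// E'E; apply: eq_integral => w.
  by rewrite inE => -[/= wc _]; rewrite (_ : (_ == _) = c).
rewrite !step !PE' [bern q k.+1 Phi]/= -(fineK (fin_num_measure P E mE)).
by rewrite -!EFinM -EFinD; congr EFin; ring.
Qed.

Lemma integral_stays (Phi : seq bool -> R) : (forall e, 0 <= Phi e) ->
  (\int[P]_w (Phi (stays (m w) n))%:E = (bern q n Phi)%:E)%E.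
Proof.
move=> Phi0; have := @integral_stays_events n [::] (fun=> true) Phi isT.
rewrite big_nil probability_setT mul1e; exact.
Qed.

Lemma grid_var_stays w :
  grid_var N T n w = h ^+ 3 * (run_sum_sq (stays (m w) n))%:R.
Proof.
rewrite run_sum_sq_stays; last exact: nd_skel.
rewrite natr_sum mulr_sumr; apply: eq_bigr => j _.
by rewrite natrX; ring.
Qed.

End grid_bern.

(** * Passage to the limit *)

Lemma cvgn_ge {R : realType} (u : nat -> R) (a l : R) :
  u n @[n --> \oo] --> l -> (forall n, a <= u n) -> a <= l.
Proof.
move=> ul au; rewrite -(cvg_lim _ ul)//; apply: limr_ge; last exact: nearW.
by apply/cvg_ex; exists l.
Qed.

Section limits.
Context d (Omega : measurableType d) (R : realType) (P : probability Omega R).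

Lemma bounded_cvg_integral (f_ : nat -> Omega -> R) (f : Omega -> R) (M : R) :
  (forall n, measurable_fun setT (f_ n)) -> (forall n w, `|f_ n w| <= M) ->
  (forall w, f_ n w @[n --> \oo] --> f w) ->
  (\int[P]_w (f_ n w)%:E)%E @[n --> \oo] --> (\int[P]_w (f w)%:E)%E.
Proof.
move=> mf fM ff.
have [] := @dominated_convergence _ _ _ P setT measurableT
  (fun n => EFin \o f_ n) (EFin \o f) (cst M%:E).
- by move=> n; exact/measurable_EFinP.
- apply/measurable_EFinP; apply: (measurable_fun_cvg mf) => w _; exact: ff.
- by apply: aeW => w _; apply/fine_cvgP; split; [exact: nearW|exact: ff].
- exact: finite_measure_integrable_cst.
- by apply: aeW => w n _; rewrite lee_fin.
by [].
Qed.

Lemma fatou_le (f_ : nat -> Omega -> R) (f : Omega -> R) (C : R) :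
  (forall n, measurable_fun setT (f_ n)) -> (forall n w, 0 <= f_ n w) ->
  (forall w, f_ n w @[n --> \oo] --> f w) ->
  (\forall n \near \oo, (\int[P]_w (f_ n w)%:E <= C%:E)%E) ->
  (\int[P]_w (f w)%:E <= C%:E)%E.
Proof.
move=> mf f0 ff [k _ Ck].
(* Shifting by [k] makes the eventual bound hold for every index. *)
pose g n w := (f_ (n + k)%N w)%:E.
have -> : (\int[P]_w (f w)%:E = \int[P]_w limn_einf (g^~ w))%E.
  apply: eq_integral => w _.
  suff cg : g^~ w @ \oo --> (f w)%:E by rewrite is_cvg_limn_einfE; [apply/esym/cvg_lim|apply/cvg_ex; exists (f w)%:E].
  apply/fine_cvgP; split; first exact: nearW.
  rewrite /comp /g /=.
  by rewrite (cvg_shiftn k (fun n => f_ n w)); exact: ff.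
apply: le_trans (fatou _ _ _ _) _ => //.
- by move=> n; exact/measurable_EFinP.
- by move=> n w _; rewrite lee_fin.
rewrite limn_einf_lim; apply: lime_le; first exact: is_cvg_einfs.
apply: nearW => n; apply: le_trans (_ : _ <= \int[P]_w g n w)%E _.
  by apply: ereal_inf_lbound; exists n => //=.
by apply: Ck; rewrite /= leq_addl.
Qed.

End limits.

Section gauss_mean.
Context {R : realType}.

(* Meaningful for bounded [f]: [fine] sends an infinite integral to 0. *)
Definition gauss_mean (f : R -> R) (v : R) : R :=
  fine (\int[gauss_law v]_z (f z)%:E)%E.

Lemma integral_prob_bounds d (Omega : measurableType d) (P : probability Omega R)
    (f : Omega -> R) (M : R) : measurable_fun setT f -> (forall x, 0 <= f x <= M) ->
  (0 <= \int[P]_x (f x)%:E <= M%:E)%E.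
Proof.
move=> mf f01; apply/andP; split.
  by apply: integral_ge0 => x _; rewrite lee_fin; have /andP[] := f01 x.
have -> : (M%:E = \int[P]_x cst M%:E x)%E.
  rewrite integral_cst// -[LHS]mule1; congr (_ * _)%E.
  exact/esym/probability_setT.
apply: ge0_le_integral => //.
- by move=> x _; rewrite lee_fin; have /andP[] := f01 x.
- exact/measurable_EFinP.
- by move=> x _; rewrite lee_fin; have /andP[] := f01 x.
Qed.

Variables (f : R -> R) (M : R).
Hypotheses (mf : measurable_fun setT f) (f0M : forall x, 0 <= f x <= M).

Lemma gauss_meanE v : (\int[gauss_law v]_z (f z)%:E = (gauss_mean f v)%:E)%E.
Proof.
have /andP[h0 hM] := @integral_prob_bounds _ _ (gauss_law v) f M mf f0M.
rewrite /gauss_mean fineK// fin_numElt (lt_le_trans _ h0)//=.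
by rewrite (le_lt_trans hM)// ltry.
Qed.

Lemma gauss_mean_itv v : 0 <= gauss_mean f v <= M.
Proof.
by have := @integral_prob_bounds _ _ (gauss_law v) f M mf f0M; rewrite gauss_meanE !lee_fin.
Qed.

Lemma gauss_mean_norm v : `|gauss_mean f v| <= M.
Proof. by have /andP[h0 hM] := gauss_mean_itv v; rewrite ger0_norm. Qed.

Lemma gauss_mean_std v :
  (\int[@normal_prob R 0 1]_z (f (Num.sqrt v * z))%:E = (gauss_mean f v)%:E)%E.
Proof.
rewrite -gauss_meanE.
have := @ge0_integral_distribution _ _ _ _ _ (@normal_prob R 0 1) (affine (Num.sqrt v) 0) (EFin \o f).
rewrite -/(gauss_law v) => ->.
- by apply: eq_integral => z _; rewrite /= /affine addr0.
- exact/measurable_EFinP.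
- by move=> z; rewrite lee_fin; have /andP[] := f0M z.
Qed.

(** Over the standard law the variance enters through the bounded continuous integrand only, so
    dominated convergence applies, also when the limit variance is 0. *)
Lemma gauss_mean_cvg (v_ : nat -> R) v : continuous f ->
  v_ n @[n --> \oo] --> v -> gauss_mean f (v_ n) @[n --> \oo] --> gauss_mean f v.
Proof.
move=> cf vv.
have : (\int[@normal_prob R 0 1]_z (f (Num.sqrt (v_ n) * z))%:E)%E @[n --> \oo] -->
    (\int[@normal_prob R 0 1]_z (f (Num.sqrt v * z))%:E)%E.
  apply: (@bounded_cvg_integral _ _ _ (@normal_prob R 0 1) (fun n z => f (Num.sqrt (v_ n) * z)) _ M).
  - by move=> n; apply: measurableT_comp => //; exact: measurable_funM.
  - by move=> n z; rewrite ger0_norm; have /andP[] := f0M (Num.sqrt (v_ n) * z).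
  - move=> z; apply: continuous_cvg; first exact: cf.
    apply: cvgMl; apply: continuous_cvg => //; exact: sqrt_continuous.
rewrite gauss_mean_std; under eq_cvg do rewrite gauss_mean_std.
by move/fine_cvgP => [].
Qed.

End gauss_mean.

(** * Law and moments of the area in continuous time *)

Section area_limit.
Context d (Omega : measurableType d) (R : realType) (P : probability Omega R).
Variables (r : R) (N : R -> {RV P >-> nat}) (B : nat -> R -> {RV P >-> R}).
Hypotheses (r0 : 0 < r) (HN : is_poisson_process r N)
  (HB : forall n, is_brownian_motion (B n)) (HI : independent_pieces N B).
Variable T : R.
Hypothesis T0 : 0 < T.

Definition area_var (w : Omega) : R :=
  (\int[lebesgue_measure]_(t in `[0%R, T]) (t - last_reset N t w) ^+ 2)%R.

Let ndN w (s t : R) : 0 <= s -> s <= t -> (pathN N w s <= pathN N w t)%N.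
Proof. by have [_ + _ _ _] := HN; apply. Qed.

Let rcN w (t : R) : 0 <= t -> \forall s \near t^'+, pathN N w s = pathN N w t.
Proof. by move=> t0; have [_ _ + _ _] := HN; move=> /(_ w t t0). Qed.

Lemma grid_area_cvg w : grid_area N B T n w @[n --> \oo] --> reset_area N B T w.
Proof.
apply: (@riemann_cvg R (pathN N w) T) => //; first exact: ndN; first exact: rcN.
by move=> k; have [_ + _ _] := HB k; apply.
Qed.

Lemma grid_var_cvg w : grid_var N T n w @[n --> \oo] --> area_var w.
Proof.
apply: (@riemann_cvg R (pathN N w) T) => //; first exact: ndN; first exact: rcN.
move=> _; apply: continuous_subspaceT; exact: exprn_continuous.
Qed.

Lemma measurable_grid_var n : measurable_fun setT (grid_var N T n).
Proof. exact: (@measurable_comp_grid_var _ _ _ _ _ _ n T0 _ _ id). Qed.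

Lemma measurable_reset_area : measurable_fun setT (reset_area N B T).
Proof.
apply: (@measurable_fun_cvg _ _ _ _ (fun n => grid_area N B T n)) => [n|w _].
  exact: measurable_grid_area.
exact: grid_area_cvg.
Qed.

Lemma measurable_area_var : measurable_fun setT area_var.
Proof.
apply: (@measurable_fun_cvg _ _ _ _ (fun n => grid_var N T n)) => [n|w _].
  exact: measurable_grid_var.
exact: grid_var_cvg.
Qed.

Lemma grid_var_ge0 n w : 0 <= grid_var N T n w.
Proof.
by apply: sumr_ge0 => j _; rewrite mulr_ge0 ?sqr_ge0// ltW// mesh_gt0.
Qed.

Lemma area_var_ge0 w : 0 <= area_var w.
Proof.
by apply: (cvgn_ge (@grid_var_cvg w)) => n; exact: grid_var_ge0.
Qed.

(** The bound of [inv_count_le] divided by the squared number of grid points. It dominates the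
    inverse number of blocks and is continuous in the grid variance, so it passes to the limit. *)
Let gap (n : nat) (w : Omega) : R :=
  n.+1%:R^-1 + 2 * Num.sqrt (grid_var N T n w / T ^+ 3).

Let gap_ge n w : (count negb (stays (skel (pathN N w) T n) n)).+1%:R^-1 <= gap n w.
Proof.
have h0 := mesh_gt0 T0 n.
have sz := size_stays (skel (pathN N w) T n) n.
have := @inv_count_le R (stays (skel (pathN N w) T n) n) n.+1%:R.
rewrite sz => /(_ erefl).
set K := (count _ _).+1%:R; set y := (run_sum_sq _)%:R => h.
have n0 : 0 < n.+1%:R :> R by rewrite ltr0n.
have n20 : 0 < n.+1%:R ^+ 2 :> R by rewrite exprn_gt0.
rewrite -(ler_pM2l n20); apply: le_trans h _.
rewrite /gap mulrDr expr2 -mulrA mulfV ?gt_eqF// mulr1 lerD2l mulrCA ler_pM2l//.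
rewrite -[n.+1%:R * n.+1%:R]ger0_norm ?mulr_ge0// -expr2 -sqrtr_sqr -sqrtrM ?sqr_ge0//.
rewrite (grid_var_stays HN n T0) -/y ler_wsqrtr//.
have -> : T ^+ 3 = (n.+1%:R * mesh T n) ^+ 3.
  by rewrite /mesh mulrCA divff ?mulr1// gt_eqF.
rewrite le_eqVlt; apply/orP; left; apply/eqP.
by field; rewrite !gt_eqF.
Qed.

Let gap_cvg w : gap n w @[n --> \oo] --> 2 * Num.sqrt (area_var w / T ^+ 3).
Proof.
rewrite -[X in _ --> X]add0r; apply: cvgD; first exact: cvg_harmonic.
apply: cvgM; first exact: cvg_cst.
apply: continuous_cvg; first exact: sqrt_continuous.
apply: cvgMl; exact: grid_var_cvg.
Qed.

(** Positivity holds on every path: no grid sees more than [N T w] resets, so [gap] stays above a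
    positive constant independent of the mesh. *)
Lemma area_var_gt0 w : 0 < area_var w.
Proof.
suff : 0 < 2 * Num.sqrt (area_var w / T ^+ 3).
  by rewrite pmulr_rgt0// sqrtr_gt0 pmulr_lgt0// invr_gt0 exprn_gt0.
apply: (@lt_le_trans _ _ (N T w).+1%:R^-1); first by rewrite invr_gt0.
apply: (cvgn_ge (@gap_cvg w)) => n; apply: le_trans (gap_ge n w).
rewrite lef_pV2 ?posrE// ler_nat ltnS.
apply: leq_trans (count_stays (nd_skel HN n T0 w) n) _.
rewrite /skel /grid /mesh mulrCA divff ?mulr1// pnatr_eq0//.
Qed.

(** [gap ^- 2] is at most the squared number of blocks, whose mean is bounded uniformly in the mesh
    because [n kappa <= r T]. Its pointwise limit is [T^3 / (4 V)], and Fatou concludes. *)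
Lemma integral_inv_area_var :
  (\int[P]_w ((area_var w)^-1)%:E <=
    (4 / T ^+ 3 * ((1 + r * T) ^+ 2 + r * T))%:E)%E.
Proof.
have gap_gt0 n w : 0 < gap n w.
  by apply: lt_le_trans (gap_ge n w); rewrite invr_gt0.
have lim_gap w : 0 < 2 * Num.sqrt (area_var w / T ^+ 3).
  by rewrite pmulr_rgt0// sqrtr_gt0 divr_gt0 ?area_var_gt0 ?exprn_gt0.
have mgap n : measurable_fun setT (fun w => gap n w ^- 2).
  exact: (@measurable_comp_grid_var _ _ _ _ _ _ n T0 _ _
    (fun v => (n.+1%:R^-1 + 2 * Num.sqrt (v / T ^+ 3)) ^- 2)).
have gapV_cvg w : gap n w ^- 2 @[n --> \oo] -->
    (2 * Num.sqrt (area_var w / T ^+ 3)) ^- 2.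
  apply: cvgV; first by rewrite gt_eqF// exprn_gt0.
  rewrite expr2; under eq_cvg do rewrite expr2.
  by apply: cvgM; exact: gap_cvg.
have key : (\int[P]_w ((2 * Num.sqrt (area_var w / T ^+ 3)) ^- 2)%:E <=
    ((1 + r * T) ^+ 2 + r * T)%:E)%E.
  apply: (@fatou_le _ _ _ _ (fun n w => gap n w ^- 2)).
  - exact: mgap.
  - by move=> n w; rewrite invr_ge0 sqr_ge0.
  - exact: gapV_cvg.
  - apply: nearW => n; have h0 := mesh_gt0 T0 n.
    apply: (@le_trans _ _ (\int[P]_w ((count negb (stays (skel (pathN N w) T n) n)).+1%:R ^+ 2)%:E)%E).
      apply: ge0_le_integral => //.
      + by move=> w _; rewrite lee_fin invr_ge0 sqr_ge0.
      + apply/measurable_EFinP.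
        exact: mgap.
      + apply/measurable_EFinP.
        exact: (measurable_stays HN n T0 n (fun e => (count negb e).+1%:R ^+ 2 : R)).
      + move=> w _; rewrite lee_fin -exprVn lerXn2r ?nnegrE ?invr_ge0 ?(ltW (gap_gt0 _ _))//.
        by rewrite -[leRHS]invrK lef_pV2 ?posrE ?invr_gt0.
    rewrite (integral_stays r0 HN n T0 (Phi := fun e => (count negb e).+1%:R ^+ 2)); last first.
      by move=> e; rewrite sqr_ge0.
    rewrite lee_fin.
    have q1 : expR (- (r * mesh T n)) <= 1.
      by rewrite expR_le1 oppr_le0 mulr_ge0// ltW.
    apply: le_trans (bern_count_sq q1 n) _.
    have k0 := ltW (kappa_gt0 r0 h0); have kle := kappa_le r (mesh T n).
    have nk0 : 0 <= n%:R * (1 - expR (- (r * mesh T n))) by rewrite mulr_ge0.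
    have nk : n%:R * (1 - expR (- (r * mesh T n))) <= r * T.
      apply: le_trans (ler_wpM2l _ kle) _ => //.
        rewrite mulrCA ler_pM2l// -[leRHS](_ : n.+1%:R * mesh T n = T).
          by rewrite ler_pM2r// ler_nat.
        by rewrite /mesh mulrCA divff ?mulr1// pnatr_eq0.
    by rewrite lerD// lerXn2r ?nnegrE ?addr_ge0 ?lerD2l// mulr_ge0 ?ltW.
have -> : (\int[P]_w ((area_var w)^-1)%:E =
    \int[P]_w ((4 / T ^+ 3)%:E * ((2 * Num.sqrt (area_var w / T ^+ 3)) ^- 2)%:E))%E.
  apply: eq_integral => w _; rewrite -EFinM; congr EFin.
  rewrite exprMn sqr_sqrtr ?divr_ge0 ?area_var_ge0 ?exprn_ge0 ?ltW//.
  by field; rewrite !gt_eqF// area_var_gt0.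
rewrite ge0_integralZl//; last 2 first.
- apply/measurable_EFinP.
  by apply: (measurable_fun_cvg mgap) => w _; exact: gapV_cvg.
- by rewrite lee_fin divr_ge0// exprn_ge0// ltW.
by rewrite [leRHS]EFinM lee_wpmul2l// lee_fin divr_ge0// exprn_ge0// ltW.
Qed.

(** In [q (1 + q) (h / kappa)^2] the factor [1 + q] produces the 2, and [h / kappa] is squeezed
    between [1 / r] and [1 / r + h]. *)
Lemma mean_rate_cvg : mean_rate r (mesh T n) @[n --> \oo] --> 2 / r ^+ 2.
Proof.
have m0 n := mesh_gt0 T0 n.
have mesh0 : mesh T n @[n --> \oo] --> 0 by exact: mesh_cvg.
have qcvg : expR (- (r * mesh T n)) @[n --> \oo] --> (1 : R).
  rewrite -[X in _ --> X]expR0; apply: continuous_cvg; first exact: continuous_expR.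
  rewrite -[X in _ --> X]oppr0 -[X in _ --> - X](mulr0 r).
  by apply: cvgN; apply: cvgMr.
have kcvg : mesh T n / (1 - expR (- (r * mesh T n))) @[n --> \oo] --> r^-1.
  apply: (@squeeze_cvgr _ _ _ _ (fun=> r^-1) (fun n => r^-1 + mesh T n)).
  - apply: nearW => n; rewrite (h_kappa_ge r0 (m0 n))/=.
    exact: h_kappa_le.
  - exact: cvg_cst.
  - by rewrite -[X in _ --> X]addr0; apply: cvgD => //; exact: cvg_cst.
have -> : 2 / r ^+ 2 = 1 * (1 + 1) * (r^-1 * r^-1).
  by field; rewrite gt_eqF.
rewrite (_ : (fun n => mean_rate r (mesh T n)) = fun n =>
    expR (- (r * mesh T n)) * (1 + expR (- (r * mesh T n))) *
    (mesh T n / (1 - expR (- (r * mesh T n))) * (mesh T n / (1 - expR (- (r * mesh T n)))))); last first.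
  by apply/funext => n; rewrite (mean_rateE r0 (m0 n)) expr2.
apply: cvgM; last exact: cvgM.
by apply: cvgM => //; apply: cvgD => //; exact: cvg_cst.
Qed.

Lemma integral_area_var_dev :
  (\int[P]_w ((area_var w - 2 / r ^+ 2 * T) ^+ 2)%:E <=
    (4 * dev_const r * (r * T + 1))%:E)%E.
Proof.
have m0 n := mesh_gt0 T0 n.
(* There are [n] steps between [n + 1] grid times, so the centring covers [T] less one mesh width;
   the defect vanishes in the limit. *)
have nT n : mesh T n * n%:R = T - mesh T n.
  apply/eqP; rewrite -subr_eq0 opprB addrA subr_eq0 -[in X in _ + X](mulr1 (mesh T n)).
  by rewrite -mulrDr natr1 /mesh divfK// pnatr_eq0.
have mesh0 : mesh T n @[n --> \oo] --> 0 by exact: mesh_cvg.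
apply: (@fatou_le _ _ _ _ (fun n w => (grid_var N T n w -
    mean_rate r (mesh T n) * mesh T n * n%:R) ^+ 2)).
- move=> n; exact: (@measurable_comp_grid_var _ _ _ _ _ _ n T0 _ _
    (fun v => (v - mean_rate r (mesh T n) * mesh T n * n%:R) ^+ 2)).
- by move=> n w; exact: sqr_ge0.
- move=> w; rewrite expr2; under eq_cvg do rewrite expr2.
  have c1 : grid_var N T n w - mean_rate r (mesh T n) * mesh T n * n%:R @[n --> \oo]
      --> area_var w - 2 / r ^+ 2 * T.
    apply: cvgB; first exact: grid_var_cvg.
    under eq_cvg do rewrite -mulrA nT.
    apply: cvgM; first exact: mean_rate_cvg.
    by rewrite -[X in _ --> X]subr0; apply: cvgB => //; exact: cvg_cst.
  exact: cvgM.
have : \forall n \near \oo, mesh T n < r^-1.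
  have rV : 0 < r^-1 by rewrite invr_gt0.
  have /cvgrPdist_lt /(_ _ rV) := mesh0.
  by apply: filterS => n; rewrite sub0r normrN gtr0_norm.
apply: filterS => n /ltW hr.
pose Phi (e : seq bool) : R := (mesh T n ^+ 3 * (run_sum_sq e)%:R -
  mean_rate r (mesh T n) * mesh T n * (size e)%:R) ^+ 2.
have -> : (\int[P]_w ((grid_var N T n w - mean_rate r (mesh T n) * mesh T n * n%:R) ^+ 2)%:E
    = \int[P]_w (Phi (stays (skel (pathN N w) T n) n))%:E)%E.
  by apply: eq_integral => w _; rewrite /Phi (grid_var_stays HN n T0) size_stays.
rewrite (integral_stays r0 HN n T0 (Phi := Phi)); last by move=> e; exact: sqr_ge0.
rewrite lee_fin; apply: le_trans (bern_V r0 (m0 n) hr n) _.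
have D0 := dev_const_ge0 r0; set D := dev_const r in D0 *.
apply: ler_wpM2l; first exact: (mulr_ge0 (ler0n _ 4) D0).
rewrite lerD2r -mulrA ler_pM2l// nT gerBl; exact: ltW.
Qed.

Lemma measurable_gauss_mean (f : R -> R) (M : R) : continuous f -> (forall x, 0 <= f x <= M) ->
  measurable_fun setT (fun w => gauss_mean f (area_var w)).
Proof.
move=> cf f0M; have mf : measurable_fun setT f by exact: continuous_measurable_fun.
apply: (@measurable_fun_cvg _ _ _ _ (fun n w => gauss_mean f (grid_var N T n w))).
  move=> n; exact: (@measurable_comp_grid_var _ _ _ _ _ _ n T0 _ _ (gauss_mean f)).
move=> w _; apply: (gauss_mean_cvg mf f0M cf); exact: grid_var_cvg.
Qed.

Lemma reset_area_mixture (f : R -> R) (M : R) : continuous f -> (forall x, 0 <= f x <= M) ->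
  (\int[P]_w (f (reset_area N B T w))%:E =
   \int[P]_w (gauss_mean f (area_var w))%:E)%E.
Proof.
move=> cf f0M; have mf : measurable_fun setT f by exact: continuous_measurable_fun.
have lhs : (\int[P]_w (f (grid_area N B T n w))%:E)%E @[n --> \oo] -->
    (\int[P]_w (f (reset_area N B T w))%:E)%E.
  apply: (@bounded_cvg_integral _ _ _ _ (fun n w => f (grid_area N B T n w)) _ M).
  - by move=> n; apply: measurableT_comp => //; exact: measurable_grid_area.
  - by move=> n w; have /andP[h0 hM] := f0M (grid_area N B T n w); rewrite ger0_norm.
  - by move=> w; apply: continuous_cvg; [exact: cf|exact: grid_area_cvg].
have rhs : (\int[P]_w (gauss_mean f (grid_var N T n w))%:E)%E @[n --> \oo] -->
    (\int[P]_w (gauss_mean f (area_var w))%:E)%E.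
  apply: (@bounded_cvg_integral _ _ _ _ (fun n w => gauss_mean f (grid_var N T n w)) _ M).
  - move=> n; exact: (@measurable_comp_grid_var _ _ _ _ _ _ n T0 _ _ (gauss_mean f)).
  - by move=> n w; exact: (gauss_mean_norm mf f0M).
  - by move=> w; apply: (gauss_mean_cvg mf f0M cf); exact: grid_var_cvg.
have E : (fun n => \int[P]_w (f (grid_area N B T n w))%:E)%E =
    (fun n => \int[P]_w (gauss_mean f (grid_var N T n w))%:E)%E.
  apply/funext => n; rewrite (grid_area_mixture HB HI n T0 mf); last first.
    by move=> x; have /andP[] := f0M x.
  by apply: eq_integral => w _; rewrite (gauss_meanE mf f0M).
rewrite E in lhs.
by rewrite -(cvg_lim _ lhs)//; apply: cvg_lim.
Qed.

End area_limit.

(** * The density and its limit *)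

Section gauss_profile.
Context {R : realType}.
Implicit Types (a b s t u x y : R).

Definition bell s : R := expR (- s ^+ 2 / 2).

Lemma bell_ge0 s : 0 <= bell s. Proof. exact: expR_ge0. Qed.

Lemma bell_le1 s : bell s <= 1.
Proof. by rewrite expR_le1 mulNr oppr_le0 divr_ge0 ?sqr_ge0. Qed.

Lemma lipschitz1 (f df : R -> R) : (forall x, is_derive x (1 : R) f (df x)) ->
  (forall x, `|df x| <= 1) -> forall x y, `|f x - f y| <= `|x - y|.
Proof.
move=> fdf df1 x y; wlog xy : x y / x <= y.
  move=> h; case: (leP x y) => [|/ltW] xy; first exact: h.
  by rewrite distrC [leRHS]distrC h.
have cf : {within `[x, y], continuous f}.
  apply: continuous_subspaceT => z; apply: differentiable_continuous.
  by apply/derivable1_diffP; have [] := fdf z.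
have [c _ fyx] := MVT_segment xy (fun z _ => fdf z) cf.
rewrite distrC fyx normrM [leRHS]distrC.
by rewrite ler_piMl.
Qed.

Lemma is_derive_bell s : is_derive s (1 : R) bell (- s * bell s).
Proof.
rewrite /bell; apply: is_derive_eq.
by rewrite /GRing.scale/=; field.
Qed.

Lemma bell_lipschitz s t : `|bell s - bell t| <= `|s - t|.
Proof.
apply: (lipschitz1 is_derive_bell) => x.
rewrite normrM normrN (ger0_norm (bell_ge0 x)) /bell mulNr expRN.
rewrite ler_pdivrMr ?expR_gt0// mul1r.
apply: le_trans (expR_ge1Dx _).
rewrite -(real_normK (num_real x)).
by have := sqr_ge0 (`|x| - 1); lra.
Qed.

(** With [y = (b x)^2] the derivative is [(1 - y) exp (- y / 2)], bounded by 1 whatever [b]; the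
    final rate is therefore uniform in [b]. *)
Lemma scaled_bell_lipschitz b s t :
  `|s * bell (b * s) - t * bell (b * t)| <= `|s - t|.
Proof.
pose df x := (1 - (b * x) ^+ 2) * bell (b * x).
apply: (@lipschitz1 (fun x => x * bell (b * x)) df) => x.
  rewrite /bell /df; apply: is_derive_eq.
  by rewrite /GRing.scale/= /bell; field.
rewrite /df normrM (ger0_norm (bell_ge0 _)) /bell mulNr expRN.
rewrite ler_pdivrMr ?expR_gt0// mul1r.
set y := (b * x) ^+ 2.
have y0 : 0 <= y by exact: sqr_ge0.
(* The tangent bound [1 + y / 2] falls below [y - 1] for large [y]. Squaring the bound at [y / 4]
   repairs this: [(1 + y / 4)^2 - (y - 1) = (y / 4 - 1)^2 + 1]. *)
have e1 := expR_ge1Dx (y / 4).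
have -> : expR (y / 2) = expR (y / 4) ^+ 2.
  by rewrite -expRM_natl; congr expR; field.
have : (1 + y / 4) ^+ 2 <= expR (y / 4) ^+ 2.
  by rewrite lerXn2r// nnegrE ?expR_ge0// addr_ge0// divr_ge0.
have := sqr_ge0 (y / 4 - 1).
rewrite ler_norml => h1 h2; apply/andP; split; nra.
Qed.

(** The centred Gaussian density parametrised by the inverse [u] of its standard deviation.
    Rescaling by [s] then turns [u] into [s u], and the comparison with the standard density becomes
    a Lipschitz estimate at [s u] and 1. *)
Definition gauss_kernel u y : R := (Num.sqrt (2 * pi))^-1 * (u * bell (y * u)).

Lemma gauss_kernel_ge0 u y : 0 <= u -> 0 <= gauss_kernel u y.
Proof. by move=> u0; rewrite !mulr_ge0 ?bell_ge0// invr_ge0 sqrtr_ge0. Qed.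

Lemma gauss_kernel_le u y : 0 <= u -> gauss_kernel u y <= (Num.sqrt (2 * pi))^-1 * (1 + u ^+ 2).
Proof.
move=> u0; rewrite ler_wpM2l ?invr_ge0 ?sqrtr_ge0//.
apply: le_trans (_ : _ <= u) _; first by rewrite ler_piMr// bell_le1.
by have := sqr_ge0 (u - 1); nra.
Qed.

Lemma gauss_kernel_lipschitz u x y : 0 <= u ->
  `|gauss_kernel u x - gauss_kernel u y| <= (Num.sqrt (2 * pi))^-1 * u ^+ 2 * `|x - y|.
Proof.
move=> u0; rewrite /gauss_kernel -!mulrBr normrM normrM.
rewrite (ger0_norm u0) ger0_norm ?invr_ge0 ?sqrtr_ge0// -mulrA.
rewrite ler_wpM2l ?invr_ge0 ?sqrtr_ge0// expr2 -mulrA ler_wpM2l//.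
apply: le_trans (bell_lipschitz _ _) _.
by rewrite -mulrBl normrM (ger0_norm u0) mulrC.
Qed.

Lemma gauss_law_kernel v (A : set R) : 0 < v -> measurable A ->
  (gauss_law v A =
   \int[lebesgue_measure]_(y in A) (gauss_kernel (Num.sqrt v)^-1 y)%:E)%E.
Proof.
move=> v0 mA; have s0 : 0 < Num.sqrt v by rewrite sqrtr_gt0.
have -> : gauss_law v A = normal_prob 0 (Num.sqrt v) A by exact: gauss_lawE.
rewrite /normal_prob; apply: eq_integral => y _; congr EFin.
rewrite normal_pdfE ?gt_eqF// /normal_peak /normal_fun /gauss_kernel /bell.
rewrite subr0 mulrA; congr (_ * expR _); last by field; rewrite gt_eqF.
rewrite -mulrnAr sqrtrM ?sqr_ge0// sqrtr_sqr gtr0_norm// invfM mulrC.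
by rewrite -mulr_natl.
Qed.

End gauss_profile.

Section continuous_density.
Context {R : realType}.
Local Notation mu := (@lebesgue_measure R).

(** Were [g x < f x], a gap [e] would persist on an interval around [x] and separate the two
    integrals there; finiteness of the integral of [g] permits the cancellation. *)
Lemma integral_le_continuous (f g : R -> R) :
  continuous f -> continuous g -> (forall x, 0 <= f x) -> (forall x, 0 <= g x) ->
  (\int[mu]_x (g x)%:E < +oo)%E ->
  (forall A, measurable A ->
    \int[mu]_(x in A) (f x)%:E = \int[mu]_(x in A) (g x)%:E)%E ->
  forall x, f x <= g x.
Proof.
move=> cf cg f0 g0 gy fg x; rewrite leNgt; apply/negP => gfx.
have mf : measurable_fun setT f by exact: continuous_measurable_fun.
have mg : measurable_fun setT g by exact: continuous_measurable_fun.
pose e := (f x - g x) / 2.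
have e0 : 0 < e by rewrite divr_gt0// subr_gt0.
have cfg : {for x, continuous (fun y => f y - g y)}.
  by apply: cvgB; [exact: cf|exact: cg].
have /cvgrPdist_lt /(_ e e0)/nbhs_ballP[dl /= dl0 Hdl] := cfg.
pose A : set R := `](x - dl), (x + dl)[%classic.
have fgA y : A y -> g y + e <= f y.
  rewrite /A/= in_itv/= -ltr_distlC => /Hdl; rewrite /= ltr_distlC => /andP[+ _].
  by rewrite /e; lra.
have mA : measurable A by exact: measurable_itv.
have muA : mu A = (dl *+ 2)%:E.
  rewrite /A lebesgue_measure_itv/= lte_fin ifT; last by lra.
  by rewrite -EFinB; congr EFin; rewrite mulr2n; ring.
have gA : (\int[mu]_(y in A) (g y)%:E \is a fin_num)%E.
  rewrite ge0_fin_numE; last by apply: integral_ge0 => y _; rewrite lee_fin.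
  apply: le_lt_trans gy; apply: ge0_subset_integral => //.
  - exact/measurable_EFinP.
  - by move=> y _; rewrite lee_fin.
have : (\int[mu]_(y in A) ((g y)%:E + e%:E) <= \int[mu]_(y in A) (f y)%:E)%E.
  apply: ge0_le_integral => //.
  - by move=> y _; rewrite -EFinD lee_fin addr_ge0// ltW.
  - apply: emeasurable_funD => //; exact/measurable_EFinP/measurable_funTS.
  - exact/measurable_EFinP/measurable_funTS.
rewrite ge0_integralD//; last 3 first.
- by move=> y _; rewrite lee_fin.
- exact/measurable_EFinP/measurable_funTS.
- by move=> y _; rewrite lee_fin ltW.
rewrite fg// [X in (_ + X)%E](_ : _ = (e * (dl *+ 2))%:E); last first.
  by rewrite [RHS]EFinM -muA; exact: integral_cst.
rewrite -[X in (_ <= X)%E]fineK// -[X in (X + _)%E]fineK// -EFinD lee_fin gerDl.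
by rewrite leNgt mulr_gt0// mulrn_wgt0.
Qed.

End continuous_density.

Section measure_of_density.
Context {R : realType} (p : R -> R).
Hypotheses (p0 : forall x, 0 <= p x) (mp : measurable_fun setT p).

(* The two proofs are arguments so that the measure structure can be inferred. *)
Definition density_measure (p0 : forall x, 0 <= p x) (mp : measurable_fun setT p)
    (A : set (measurableTypeR R)) : \bar R :=
  (\int[lebesgue_measure]_(x in A) (p x)%:E)%E.

Local Notation nu := (density_measure p0 mp).

Let nu0 : nu set0 = 0%E. Proof. exact: integral_set0. Qed.

Let nu_ge0 A : (0 <= nu A)%E.
Proof. by apply: integral_ge0 => x _; rewrite lee_fin. Qed.

Let nu_sigma_additive : semi_sigma_additive nu.
Proof.
move=> F mF tF mUF; rewrite /density_measure ge0_integral_bigcup//.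
- apply: is_cvg_ereal_nneg_natsum_cond => n _ _; exact: nu_ge0.
- exact/measurable_EFinP/measurable_funTS.
- by move=> x _; rewrite lee_fin.
Qed.

HB.instance Definition _ := isMeasure.Build _ _ _ nu nu0 nu_ge0 nu_sigma_additive.

End measure_of_density.

Lemma le_integral_add d (Omega : measurableType d) (R : realType)
    (P : {measure set Omega -> \bar R}) (f g h : Omega -> R) (a b c : R) :
  measurable_fun setT f -> measurable_fun setT g -> measurable_fun setT h ->
  (forall w, 0 <= f w) -> (forall w, 0 <= g w) -> (forall w, 0 <= h w) ->
  (\int[P]_w (f w)%:E)%E = a%:E -> (\int[P]_w (g w)%:E)%E = b%:E ->
  (\int[P]_w (h w)%:E <= c%:E)%E -> (forall w, f w <= g w + h w) -> a <= b + c.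
Proof.
move=> mf mg mh f0 g0 h0 fa gb hc fgh.
rewrite -lee_fin EFinD -fa -gb.
apply: (@le_trans _ _ (\int[P]_w (g w)%:E + \int[P]_w (h w)%:E)%E); last exact: leeD2l.
have mE (u : Omega -> R) : measurable_fun setT u -> measurable_fun setT (fun w => (u w)%:E).
  by move=> mu; exact/measurable_EFinP.
have E0 (u : Omega -> R) : (forall w, 0 <= u w) -> forall w, setT w -> (0 <= (u w)%:E)%E.
  by move=> u0 w _; rewrite lee_fin.
rewrite -(ge0_integralD P measurableT (E0 _ g0) (mE _ mg) (E0 _ h0) (mE _ mh)).
apply: ge0_le_integral => //; first exact: E0.
- exact: mE.
- by apply: emeasurable_funD; exact: mE.
- by move=> w _; rewrite -EFinD lee_fin.
Qed.

Lemma continuous_of_lipschitz {R : realType} (f : R -> R) (C : R) : 0 <= C ->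
  (forall x y, f x <= f y + C * `|x - y|) -> continuous f.
Proof.
move=> C0 fC x; apply/cvgrPdist_lt => e e0.
have dl0 : 0 < e / (C + 1) by rewrite divr_gt0// ltr_wpDl.
apply/nbhs_ballP; exists (e / (C + 1)) => // y /= xy.
have Cxy : C * `|x - y| < e.
  apply: (@le_lt_trans _ _ ((C + 1) * `|x - y|)); first by rewrite ler_wpM2r// lerDl.
  by rewrite mulrC -ltr_pdivlMr// ltr_wpDl.
have := fC x y; have := fC y x; rewrite distrC => h1 h2.
by rewrite ltr_norml; apply/andP; split; lra.
Qed.

(** * The Gaussian mixture as continuous density of the area *)

Section area_density.
Context d (Omega : measurableType d) (R : realType) (P : probability Omega R).
Variables (r : R) (N : R -> {RV P >-> nat}) (B : nat -> R -> {RV P >-> R}).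
Hypotheses (r0 : 0 < r) (HN : is_poisson_process r N)
  (HB : forall n, is_brownian_motion (B n)) (HI : independent_pieces N B).
Variable T : R.
Hypothesis T0 : 0 < T.

Local Notation V := (area_var N T).
Local Notation area := (reset_area N B T).
Let V0 w : 0 < V w := area_var_gt0 HN T0 w.
Let mV : measurable_fun setT V := measurable_area_var HN T0.

Definition inv_dev (w : Omega) : R := (Num.sqrt (V w))^-1.
Local Notation U := inv_dev.

Lemma inv_dev_gt0 w : 0 < U w.
Proof. by rewrite invr_gt0 sqrtr_gt0. Qed.

Lemma inv_dev_sq w : U w ^+ 2 = (V w)^-1.
Proof. by rewrite exprVn sqr_sqrtr// ltW. Qed.

Lemma measurable_inv_dev : measurable_fun setT U.
Proof.
(* For positive variance the inverse square root is [exp (- ln v / 2)], a composition of measurable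
   functions. *)
have -> : U = expR \o (fun w => - (ln (V w) / 2)).
  apply/funext => w; rewrite /= expRN /U; congr (_^-1).
  apply/eqP; rewrite -(eqrXn2 (ltac:(by []) : (0 < 2)%N)) ?sqrtr_ge0 ?expR_ge0//.
  rewrite sqr_sqrtr ?ltW// -expRM_natl mulrC divfK// lnK//.
  exact: V0.
apply: measurableT_comp => //; apply: measurableT_comp => //.
apply: measurable_funM => //.
exact: measurableT_comp (@measurable_ln R) mV.
Qed.

(** Since [|t| + t] is 0 for [t <= 0] and [2 t] beyond, this is 1 on the ray and decays
    geometrically in [n] off it: a continuous approximation of the indicator, to which the mixture
    identity for continuous functions applies. *)
Definition ray_fun (x : R) (n : nat) (y : R) : R :=
  expR (- (`|y - x| + (y - x))) ^+ n.

Lemma ray_fun01 x n y : 0 <= ray_fun x n y <= 1.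
Proof.
rewrite exprn_ge0 ?expR_ge0//= exprn_ile1 ?expR_ge0//.
rewrite expR_le1 oppr_le0 -lerBlDr sub0r.
by rewrite -normrN ler_norm.
Qed.

Lemma continuous_ray_fun x n : continuous (ray_fun x n).
Proof.
move=> y.
apply: (@continuous_comp _ _ _ (fun y => expR (- (`|y - x| + (y - x))))
  (fun z : R => z ^+ n)); last exact: exprn_continuous.
apply: (@continuous_comp _ _ _ (fun y => - (`|y - x| + (y - x))) expR);
  last exact: continuous_expR.
apply: cvgN; apply: cvgD; last by apply: cvgB; [exact: cvg_id|exact: cvg_cst].
by apply: cvg_norm; apply: cvgB; [exact: cvg_id|exact: cvg_cst].
Qed.

Lemma ray_fun_cvg x y : ray_fun x n y @[n --> \oo] --> (\1_`]-oo, x]%classic y : R).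
Proof.
rewrite indicE; case: (boolP (y \in _)); rewrite ?inE ?notin_setE /= in_itv/=.
  move=> yx; rewrite /ray_fun ler0_norm ?subr_le0// addNr oppr0 expR0.
  by under eq_cvg do rewrite expr1n; exact: cvg_cst.
move=> /negP; rewrite -ltNge => xy.
apply: cvg_expr; rewrite ger0_norm ?expR_ge0// expR_lt1 oppr_lt0.
have yx : 0 < y - x by rewrite subr_gt0.
by rewrite gtr0_norm// addr_gt0.
Qed.

Let ray_mean (x v : R) : R := fine (gauss_law v `]-oo, x]%classic).

Let gauss_mean_ray x v : gauss_mean (ray_fun x n) v @[n --> \oo] --> ray_mean x v.
Proof.
have h : (\int[gauss_law v]_z (ray_fun x n z)%:E)%E @[n --> \oo] -->
    (\int[gauss_law v]_z (\1_`]-oo, x]%classic z)%:E)%E.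
  apply: (@bounded_cvg_integral _ _ _ (gauss_law v) (ray_fun x) _ 1).
  - by move=> n; apply: continuous_measurable_fun; exact: continuous_ray_fun.
  - by move=> n z; have /andP[? ?] := ray_fun01 x n z; rewrite ger0_norm.
  - exact: ray_fun_cvg.
have E : (\int[gauss_law v]_z (\1_`]-oo, x]%classic z)%:E)%E = (ray_mean x v)%:E.
  by rewrite integral_indic// setIT /ray_mean fineK//; exact: fin_num_measure.
rewrite E in h.
by move/fine_cvgP : h => [].
Qed.

Lemma reset_area_ray x :
  (P (area @^-1` `]-oo, x]) = \int[P]_w (fine (gauss_law (V w) `]-oo, x]%classic))%:E)%E.
Proof.
have marea : measurable_fun setT area by exact: (measurable_reset_area HN HB T0).
have cray n := @continuous_ray_fun x n.
have lhs : (\int[P]_w (ray_fun x n (area w))%:E)%E @[n --> \oo] -->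
    (P (area @^-1` `]-oo, x])).
  have -> : P (area @^-1` `]-oo, x]) = (\int[P]_w (\1_`]-oo, x]%classic (area w))%:E)%E.
    have mpre : measurable (area @^-1` `]-oo, x]).
      by rewrite -[X in measurable X]setTI; exact: marea.
    by rewrite -[in LHS](setIT (area @^-1` _)) -integral_indic.
  apply: (@bounded_cvg_integral _ _ _ P (fun n w => ray_fun x n (area w)) _ 1).
  - by move=> n; apply: measurableT_comp => //; exact: continuous_measurable_fun.
  - by move=> n w; have /andP[? ?] := ray_fun01 x n (area w); rewrite ger0_norm.
  - by move=> w; exact: ray_fun_cvg.
have rhs : (\int[P]_w (gauss_mean (ray_fun x n) (V w))%:E)%E @[n --> \oo] -->
    (\int[P]_w (ray_mean x (V w))%:E)%E.
  apply: (@bounded_cvg_integral _ _ _ P (fun n w => gauss_mean (ray_fun x n) (V w)) _ 1).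
  - by move=> n; exact: (measurable_gauss_mean HN T0 (cray n) (ray_fun01 x n)).
  - move=> n w; apply: gauss_mean_norm; last exact: ray_fun01.
    exact: continuous_measurable_fun.
  - by move=> w; exact: gauss_mean_ray.
have E : (fun n => \int[P]_w (ray_fun x n (area w))%:E)%E =
    (fun n => \int[P]_w (gauss_mean (ray_fun x n) (V w))%:E)%E.
  apply/funext => n.
  exact: (reset_area_mixture HN HB HI T0 (cray n) (ray_fun01 x n)).
rewrite E in lhs.
by rewrite -(cvg_lim _ lhs)//; apply: cvg_lim.
Qed.

Definition area_density (y : R) : R :=
  fine (\int[P]_w (gauss_kernel (U w) y)%:E)%E.

Local Notation c0 := ((Num.sqrt (2 * pi))^-1 : R).

Lemma integral_inv_dev_sq :
  (\int[P]_w (U w ^+ 2)%:E <= (4 / T ^+ 3 * ((1 + r * T) ^+ 2 + r * T))%:E)%E.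
Proof.
by under eq_integral do rewrite inv_dev_sq; exact: integral_inv_area_var.
Qed.

Lemma measurable_gauss_kernel y : measurable_fun setT (fun w => gauss_kernel (U w) y).
Proof.
have mU := measurable_inv_dev.
apply: measurable_funM => //; apply: measurable_funM => //.
rewrite /bell; apply: measurableT_comp => //; apply: measurable_funM => //.
by apply: measurableT_comp => //; apply: measurable_funX; exact: measurable_funM.
Qed.

Lemma integral_gauss_kernel_fin y :
  (\int[P]_w (gauss_kernel (U w) y)%:E)%E = (area_density y)%:E.
Proof.
rewrite fineK// ge0_fin_numE; last first.
  by apply: integral_ge0 => w _; rewrite lee_fin gauss_kernel_ge0// ltW// inv_dev_gt0.
apply: (@le_lt_trans _ _ (\int[P]_w (c0%:E * (1 + (U w ^+ 2)%:E)))%E).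
  apply: ge0_le_integral => //.
  - by move=> w _; rewrite lee_fin gauss_kernel_ge0// ltW// inv_dev_gt0.
  - exact/measurable_EFinP/measurable_gauss_kernel.
  - apply: measurable_funeM; apply: emeasurable_funD => //.
    by apply/measurable_EFinP/measurable_funX; exact: measurable_inv_dev.
  - by move=> w _; rewrite lee_fin gauss_kernel_le// ltW// inv_dev_gt0.
rewrite ge0_integralZl//; last 2 first.
- apply: emeasurable_funD => //.
  by apply/measurable_EFinP/measurable_funX; exact: measurable_inv_dev.
- by move=> w _; rewrite adde_ge0// lee_fin sqr_ge0.
rewrite lte_mul_pinfty// ?lee_fin ?invr_ge0 ?sqrtr_ge0//.
rewrite ge0_integralD//; last 2 first.
- by move=> w _; rewrite lee_fin sqr_ge0.
- by apply/measurable_EFinP/measurable_funX; exact: measurable_inv_dev.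
rewrite lte_add_pinfty//.
  by rewrite integral_cst// mul1e; apply: le_lt_trans (probability_le1 _ _) _; rewrite ?ltry.
by apply: le_lt_trans integral_inv_dev_sq _; rewrite ltry.
Qed.

Lemma area_density_ge0 y : 0 <= area_density y.
Proof.
rewrite fine_ge0//; apply: integral_ge0 => w _.
by rewrite lee_fin gauss_kernel_ge0// ltW// inv_dev_gt0.
Qed.

Lemma continuous_area_density : continuous area_density.
Proof.
pose C : R := c0 * (4 / T ^+ 3 * ((1 + r * T) ^+ 2 + r * T)).
have T3 : 0 <= 4 / T ^+ 3 by rewrite divr_ge0// exprn_ge0// ltW.
have c00 : 0 <= c0 by rewrite invr_ge0 sqrtr_ge0.
have C0 : 0 <= C.
  by rewrite mulr_ge0// mulr_ge0// addr_ge0 ?sqr_ge0// mulr_ge0// ltW.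
have mU2 : measurable_fun setT (fun w => U w ^+ 2).
  by apply: measurable_funX; exact: measurable_inv_dev.
apply: (continuous_of_lipschitz C0) => x y.
apply: (@le_integral_add _ _ _ P (fun w => gauss_kernel (U w) x)
  (fun w => gauss_kernel (U w) y) (fun w => (c0 * `|x - y|) * U w ^+ 2)).
- exact: measurable_gauss_kernel.
- exact: measurable_gauss_kernel.
- exact: measurable_funM.
- by move=> w; rewrite gauss_kernel_ge0// ltW// inv_dev_gt0.
- by move=> w; rewrite gauss_kernel_ge0// ltW// inv_dev_gt0.
- by move=> w; rewrite mulr_ge0 ?sqr_ge0// mulr_ge0.
- exact: integral_gauss_kernel_fin.
- exact: integral_gauss_kernel_fin.
- under eq_integral do rewrite EFinM.
  have k0 : (0 <= (c0 * `|x - y|)%:E)%E by rewrite lee_fin mulr_ge0.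
  rewrite ge0_integralZl//; last 2 first.
  + exact/measurable_EFinP.
  + by move=> w _; rewrite lee_fin sqr_ge0.
  rewrite /C mulrAC EFinM; exact: lee_wpmul2l integral_inv_dev_sq.
- move=> w; have := gauss_kernel_lipschitz x y (ltW (inv_dev_gt0 w)).
  rewrite mulrAC => /(le_trans (ler_norm _)).
  by rewrite lerBlDl.
Qed.

Lemma integral_area_density (A : set R) : measurable A ->
  (\int[lebesgue_measure]_(y in A) (area_density y)%:E =
   \int[P]_w gauss_law (V w) A)%E.
Proof.
move=> mA.
pose K (z : Omega * measurableTypeR R) : \bar R :=
  (\1_A z.2 * gauss_kernel (U z.1) z.2)%:E.
have mK : measurable_fun setT K.
  apply/measurable_EFinP; apply: measurable_funM.
    by apply: measurableT_comp => //; exact: measurable_indic.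
  have mU1 : measurable_fun setT (fun z : Omega * measurableTypeR R => U z.1).
    exact: measurableT_comp measurable_inv_dev measurable_fst.
  have mU2 : measurable_fun setT (fun z : Omega * measurableTypeR R => z.2 : R).
    exact: measurable_snd.
  apply: measurable_funM => //; apply: measurable_funM => //.
  rewrite /bell; apply: measurableT_comp => //; apply: measurable_funM => //.
  by apply: measurableT_comp => //; apply: measurable_funX; exact: measurable_funM.
have K0 z : (0 <= K z)%E.
  by rewrite lee_fin mulr_ge0// gauss_kernel_ge0// ltW// inv_dev_gt0.
transitivity (\int[lebesgue_measure]_y \int[P]_w K (w, y))%E.
  rewrite integral_mkcond; apply: eq_integral => y _.
  rewrite patchE /K/= indicE; case: ifP => _.
    by rewrite -integral_gauss_kernel_fin; apply: eq_integral => w _; rewrite mul1r.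
  by rewrite integral0_eq// => w _; rewrite mul0r.
transitivity (\int[P]_w \int[lebesgue_measure]_y K (w, y))%E.
  by rewrite fubini_tonelli.
apply: eq_integral => w _.
rewrite gauss_law_kernel// [RHS]integral_mkcond; apply: eq_integral => y _.
by rewrite patchE /K/= indicE; case: ifP => _; rewrite ?mul1r ?mul0r.
Qed.

Lemma has_continuous_density_area :
  has_continuous_density P area area_density.
Proof.
have marea : measurable_fun setT area by exact: (measurable_reset_area HN HB T0).
have mdens := continuous_measurable_fun continuous_area_density.
split; last exact: continuous_area_density.
split => //; first exact: area_density_ge0.
move=> A mA.
pose S : Omega -> measurableTypeR R := area.
have mS : measurable_fun setT S by exact: marea.
pose X : {mfun Omega >-> measurableTypeR R} := mfun_Sub (mem_set mS).
suff h : forall A, measurable A ->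
    pushforward P X A = density_measure area_density_ge0 mdens A by exact: h.
apply: measure_eq_rays.
- change (P (X @^-1` setT) < +oo)%E; rewrite preimage_setT.
  by apply: le_lt_trans (probability_le1 _ _) _; rewrite ?ltry.
- rewrite /= /density_measure integral_area_density//.
  under eq_integral do rewrite probability_setT.
  by rewrite integral_cst// mul1e; apply: le_lt_trans (probability_le1 _ _) _; rewrite ?ltry.
- move=> x; rewrite /= /density_measure integral_area_density//.
  rewrite [LHS]reset_area_ray; apply: eq_integral => w _.
  by rewrite fineK// fin_num_measure.
Qed.

End area_density.

Lemma continuous_density_unique d (Omega : measurableType d) (R : realType)
    (P : probability Omega R) (X : Omega -> R) (f g : R -> R) :
  has_continuous_density P X f -> has_continuous_density P X g -> f = g.
Proof.
have one (h : R -> R) : has_continuous_density P X h ->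
    (\int[lebesgue_measure]_x (h x)%:E < +oo)%E.
  move=> [[mX _ _ XE] _]; rewrite -XE// preimage_setT.
  by apply: le_lt_trans (probability_le1 _ _) _; rewrite ?ltry.
move=> Hf Hg; have f1 := one _ Hf; have g1 := one _ Hg.
have [[mX _ f0 fE] cf] := Hf; have [[_ _ g0 gE] cg] := Hg.
have fg A : measurable A -> (\int[lebesgue_measure]_(x in A) (f x)%:E =
    \int[lebesgue_measure]_(x in A) (g x)%:E)%E.
  by move=> mA; rewrite -fE// gE.
apply/funext => x; apply/eqP; rewrite eq_le.
by rewrite !integral_le_continuous// => A mA; rewrite fg.
Qed.

(** * Rate of convergence of the rescaled density *)

Section clt.
Context d (Omega : measurableType d) (R : realType) (P : probability Omega R).
Variables (r : R) (N : R -> {RV P >-> nat}) (B : nat -> R -> {RV P >-> R}).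
Hypotheses (r0 : 0 < r) (HN : is_poisson_process r N)
  (HB : forall n, is_brownian_motion (B n)) (HI : independent_pieces N B).
Local Notation c0 := ((Num.sqrt (2 * pi))^-1 : R).
Local Notation sigma := (Num.sqrt 2 / r).

(** Here [z] is the inverse square root of [v]. From [|v - 1| z = |z - 1| (1 + 1 / z)] one gets
    [|z - 1| <= |v - 1| z], and a weighted arithmetic-geometric inequality separates the deviation
    from the inverse moment. *)
Lemma dist_inv_sqrt_le (lambda v z : R) : 0 < lambda -> 0 < z -> z ^+ 2 * v = 1 ->
  `|z - 1| <= 2^-1 * (lambda * (v - 1) ^+ 2 + z ^+ 2 / lambda).
Proof.
move=> l0 z0 zv.
apply: (@le_trans _ _ (`|v - 1| * z)).
  have z2 : z ^+ 2 != 0 by rewrite gt_eqF// exprn_gt0.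
  have -> : v = (z ^+ 2)^-1 by apply: (mulfI z2); rewrite zv mulfV.
  have -> : (z ^+ 2)^-1 - 1 = - ((z - 1) * ((z + 1) / z ^+ 2)) by field; rewrite gt_eqF.
  rewrite normrN normrM -mulrA ler_peMr// ger0_norm; last first.
    by rewrite divr_ge0 ?sqr_ge0// addr_ge0// ltW.
  rewrite (_ : _ * z = 1 + z^-1); last by field; rewrite gt_eqF.
  by rewrite lerDl invr_ge0 ltW.
have l20 : 0 < Num.sqrt lambda by rewrite sqrtr_gt0.
have ll : lambda = Num.sqrt lambda ^+ 2 by rewrite sqr_sqrtr// ltW.
rewrite ll -(real_normK (num_real (v - 1))).
set a := `|v - 1|; set q := Num.sqrt lambda in l20 *.
have -> : 2^-1 * (q ^+ 2 * a ^+ 2 + z ^+ 2 / q ^+ 2) =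
    a * z + 2^-1 * (q * a - z / q) ^+ 2 by field; rewrite gt_eqF.
by rewrite lerDl mulr_ge0// sqr_ge0.
Qed.

(** Half the sum of the two rescaled moment bounds, times the Gaussian normalisation; lower-order
    terms in [T] are absorbed by [T >= 1]. *)
Definition clt_const : R :=
  c0 * (2^-1 * (dev_const r * r ^+ 4 * (r + 1) + 8 / r ^+ 2 * ((1 + r) ^+ 2 + r))).

Lemma clt_bound (T b : R) : 1 <= T ->
  `|sigma * Num.sqrt T * area_density N T (sigma * Num.sqrt T * b) - c0 * bell b|
  <= clt_const / Num.sqrt T.
Proof.
move=> T1; have T0 : 0 < T by apply: lt_le_trans T1.
set t := Num.sqrt T; have t0 : 0 < t by rewrite sqrtr_gt0.
have tT : t ^+ 2 = T by rewrite sqr_sqrtr// ltW.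
set s := sigma * t.
have s0 : 0 < s by rewrite mulr_gt0// divr_gt0// sqrtr_gt0.
have s2 : s ^+ 2 = 2 / r ^+ 2 * T by rewrite !exprMn exprVn sqr_sqrtr// tT.
have c00 : 0 < c0 by rewrite invr_gt0 sqrtr_gt0 mulr_gt0// pi_gt0.
pose V := area_var N T; pose U := inv_dev N T.
have U0 w : 0 < U w := inv_dev_gt0 HN T0 w.
have mU : measurable_fun setT U := measurable_inv_dev HN T0.
have mV : measurable_fun setT V := measurable_area_var HN T0.
have V0 w : 0 < V w := area_var_gt0 HN T0 w.
pose dev (w : Omega) := c0 * (2^-1 *
  (t / s ^+ 4 * (V w - 2 / r ^+ 2 * T) ^+ 2 + s ^+ 2 / t * U w ^+ 2)).
have dev_le w : `|s * gauss_kernel (U w) (s * b) - c0 * bell b| <= dev w.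
  have -> : s * gauss_kernel (U w) (s * b) - c0 * bell b =
      c0 * (s * U w * bell (b * (s * U w)) - 1 * bell (b * 1)).
    by rewrite /gauss_kernel mulr1 mul1r (_ : s * b * U w = b * (s * U w)); ring.
  rewrite normrM (gtr0_norm c00) /dev ler_pM2l//.
  apply: le_trans (scaled_bell_lipschitz _ _ _) _.
  (* The weight [sqrt T] balances the two terms: the normalised squared deviation has mean O(1/T)
     and the normalised inverse variance has bounded mean, so both become O(T^(-1/2)). *)
  apply: le_trans (@dist_inv_sqrt_le t (V w / s ^+ 2) _ t0 _ _) _.
  - by rewrite mulr_gt0.
  - rewrite exprMn (inv_dev_sq HN T0) -/V; field.
    by rewrite !gt_eqF.
  rewrite -s2 le_eqVlt; apply/orP; left; apply/eqP.
  by field; rewrite !gt_eqF.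
have mdev2 : measurable_fun setT (fun w => (V w - 2 / r ^+ 2 * T) ^+ 2).
  by apply: measurable_funX; exact: measurable_funB.
have mU2 : measurable_fun setT (fun w => U w ^+ 2) by exact: measurable_funX.
have mdev : measurable_fun setT dev.
  by do 2 apply: measurable_funM => //; apply: measurable_funD; exact: measurable_funM.
have ts0 : 0 <= t / s ^+ 4 by rewrite divr_ge0// ?exprn_ge0// ltW.
have st0 : 0 <= s ^+ 2 / t by rewrite divr_ge0// ?sqr_ge0// ltW.
have dev0 w : 0 <= dev w.
  rewrite mulr_ge0 ?(ltW c00)// mulr_ge0// addr_ge0// mulr_ge0//; exact: sqr_ge0.
have mE (u : Omega -> R) : measurable_fun setT u -> measurable_fun setT (fun w => (u w)%:E).
  by move=> mu; exact/measurable_EFinP.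
have E0 (u : Omega -> R) : (forall w, 0 <= u w) -> forall w, setT w -> (0 <= (u w)%:E)%E.
  by move=> u0 w _; rewrite lee_fin.
have intZ (k : R) (u : Omega -> R) : 0 <= k -> measurable_fun setT u -> (forall w, 0 <= u w) ->
    (\int[P]_w (k * u w)%:E = k%:E * \int[P]_w (u w)%:E)%E.
  move=> k0 mu u0; under eq_integral do rewrite EFinM.
  by rewrite ge0_integralZl//; [exact: mE|exact: E0].
have int_dev : (\int[P]_w (dev w)%:E <= (clt_const / t)%:E)%E.
  rewrite intZ ?(ltW c00)//; last 2 first.
  - by apply: measurable_funM => //; apply: measurable_funD; exact: measurable_funM.
  - by move=> w; rewrite mulr_ge0// addr_ge0// mulr_ge0//; exact: sqr_ge0.
  rewrite intZ//; last 2 first.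
  - by apply: measurable_funD; exact: measurable_funM.
  - by move=> w; rewrite addr_ge0// mulr_ge0//; exact: sqr_ge0.
  have -> : (\int[P]_w (t / s ^+ 4 * (V w - 2 / r ^+ 2 * T) ^+ 2 + s ^+ 2 / t * U w ^+ 2)%:E =
      \int[P]_w (t / s ^+ 4 * (V w - 2 / r ^+ 2 * T) ^+ 2)%:E +
      \int[P]_w (s ^+ 2 / t * U w ^+ 2)%:E)%E.
    apply: (ge0_integralD P measurableT (E0 _ _) (mE _ _) (E0 _ _) (mE _ _)).
    - by move=> w; rewrite mulr_ge0//; exact: sqr_ge0.
    - exact: measurable_funM.
    - by move=> w; rewrite mulr_ge0//; exact: sqr_ge0.
    - exact: measurable_funM.
  rewrite !intZ//; last 2 first.
  - by move=> w; exact: sqr_ge0.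
  - by move=> w; exact: sqr_ge0.
  have D0 := dev_const_ge0 r0.
  have h1 := lee_wpmul2l (ts0 : (0 <= (t / s ^+ 4)%:E)%E) (integral_area_var_dev r0 HN T0).
  have h2 := lee_wpmul2l (st0 : (0 <= (s ^+ 2 / t)%:E)%E) (integral_inv_dev_sq r0 HN T0).
  have c2 : (0 <= (2^-1 : R)%:E)%E by rewrite lee_fin.
  have h3 := lee_wpmul2l (ltW c00 : (0 <= c0%:E)%E) (lee_wpmul2l c2 (leeD h1 h2)).
  apply: le_trans h3 _.
  rewrite -(EFinM (t / s ^+ 4)) -(EFinM (s ^+ 2 / t)) -EFinD -(EFinM 2^-1) -(EFinM c0).
  rewrite lee_fin /clt_const -[leRHS]mulrA ler_pM2l// -[leRHS]mulrA ler_pM2l//.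
  rewrite [leRHS]mulrDl; apply: lerD.
  - have -> : s ^+ 4 = (2 / r ^+ 2 * t ^+ 2) ^+ 2 by rewrite tT -s2 -exprM.
    have -> : t / (2 / r ^+ 2 * t ^+ 2) ^+ 2 * (4 * dev_const r * (r * T + 1)) =
        dev_const r * r ^+ 4 * ((r * T + 1) / t ^+ 2) / t by field; rewrite !gt_eqF.
    rewrite ler_pM2r ?invr_gt0// ler_wpM2l//.
      by rewrite mulr_ge0// exprn_ge0// ltW.
    rewrite tT ler_pdivrMr// mulrDl mul1r lerD2l//.
  - rewrite s2.
    have -> : 2 / r ^+ 2 * T / t * (4 / T ^+ 3 * ((1 + r * T) ^+ 2 + r * T)) =
       8 / r ^+ 2 * (((1 + r * T) ^+ 2 + r * T) / T ^+ 2) / t by field; rewrite !gt_eqF.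
    rewrite ler_pM2r ?invr_gt0// ler_wpM2l//.
      by rewrite divr_ge0// exprn_ge0// ltW.
    rewrite ler_pdivrMr ?exprn_gt0// mulrDl -exprMn lerD//.
      rewrite lerXn2r ?nnegrE ?mulr_ge0 ?addr_ge0 ?mulr_ge0 ?(ltW r0) ?(ltW T0)//.
      by rewrite mulrDl mul1r lerD2r.
    by rewrite ler_pM2l// expr2 ler_peMl// ltW.
have mk : measurable_fun setT (fun w => s * gauss_kernel (U w) (s * b)).
  by apply: measurable_funM => //; exact: (measurable_gauss_kernel HN T0 (s * b)).
have k0 w : 0 <= s * gauss_kernel (U w) (s * b).
  by rewrite mulr_ge0 ?(ltW s0)// gauss_kernel_ge0// ltW.
have b0 : 0 <= c0 * bell b by rewrite mulr_ge0 ?(ltW c00)// bell_ge0.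
have int_k : (\int[P]_w (s * gauss_kernel (U w) (s * b))%:E)%E =
    (s * area_density N T (s * b))%:E.
  rewrite intZ ?(ltW s0)//; last 2 first.
  - exact: (measurable_gauss_kernel HN T0 (s * b)).
  - by move=> w; rewrite gauss_kernel_ge0// ltW.
  by rewrite (integral_gauss_kernel_fin r0 HN T0).
have int_c : (\int[P]_w (cst (c0 * bell b) w)%:E)%E = (c0 * bell b)%:E.
  transitivity (\int[P]_w cst (c0 * bell b)%:E w)%E; first by [].
  by rewrite integral_cst// -[RHS]mule1; congr (_ * _)%E; exact: probability_setT.
rewrite ler_norml; apply/andP; split.
- rewrite lerNl opprB lerBlDl.
  apply: (le_integral_add (measurable_cst _) mk mdev _ k0 dev0 int_c int_k int_dev) => // w.
  by have := dev_le w; rewrite distrC => /(le_trans (ler_norm _)); rewrite lerBlDl.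
- rewrite lerBlDl.
  apply: (le_integral_add mk (measurable_cst _) mdev k0 _ dev0 int_k int_c int_dev) => // w.
  by have := dev_le w => /(le_trans (ler_norm _)); rewrite lerBlDl.
Qed.

End clt.

Theorem theorem5p2 (d : measure_display) (Omega : measurableType d)
    (R : realType) (P : probability Omega R) (r : R)
    (N : R -> {RV P >-> nat}) (B : nat -> R -> {RV P >-> R}) :
  0 < r ->
  is_poisson_process r N ->
  (forall n, is_brownian_motion (B n)) ->
  independent_pieces N B ->
  let sigma := Num.sqrt 2 / r in
  (forall T : R, 0 < T ->
     exists f, has_continuous_density P (reset_area N B T) f) /\
  (forall p : R -> R -> R,
     (forall T : R, 0 < T -> has_continuous_density P (reset_area N B T) (p T)) ->
     forall b : R,
       sigma * Num.sqrt T * p T (sigma * Num.sqrt T * b) @[T --> +oo]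
         --> (Num.sqrt (2 * pi))^-1 * expR (- b ^+ 2 / 2)).
Proof.
move=> r0 HN HB HI sigma; split=> [T T0|p Hp b].
  by exists (area_density N T); exact: (has_continuous_density_area r0 HN HB HI T0).
have pE (T : R) : 0 < T -> p T = area_density N T.
  move=> T0; apply: (continuous_density_unique (Hp T T0)).
  exact: (has_continuous_density_area r0 HN HB HI T0).
apply/cvgrPdist_le => e e0.
pose K := clt_const r.
near=> T.
have T1 : 1 <= T by near: T; exact: nbhs_pinfty_ge.
have T0 : 0 < T by apply: lt_le_trans T1.
rewrite pE// distrC; apply: le_trans (clt_bound r0 HN b T1) _.
rewrite ler_pdivrMr ?sqrtr_gt0// mulrC -ler_pdivrMr//.
(* With [|K / e|] as the square root of its square, it suffices that [T >= (K / e)^2]. *)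
apply: (@le_trans _ _ `|K / e|); first exact: ler_norm.
rewrite -sqrtr_sqr ler_wsqrtr//.
Unshelve. all: by end_near. Qed.
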